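(* Let $q\in\,]-1,1[\,\setminus\{0\}$, $\mathbb{G}=\mathrm{SU}_q(2)$, $\Gamma=\widehat{\mathrm{SU}_q(2)}$. For each $t\in\mathbb{R}$, the operator $\mathcal{Q}_LP^{it}\mathcal{Q}_L^*$ acts on $\int^\oplus_{\mathrm{Irr}(\Gamma)}\mathrm{HS}(\mathsf{H}_\lambda)\,d\mu(\lambda)$ as follows: \[ \mathcal{Q}_LP^{it}\mathcal{Q}_L^*:\int^\oplus_{\mathrm{Irr}(\Gamma)}T_\lambda\,d\mu(\lambda)\mapsto\int^\oplus_{\mathrm{Irr}(\Gamma)}T_{\lambda|q|^{2it}}\,d\mu(\lambda). \]
   Context: $\mathrm{SU}_q(2)$ is Woronowicz's compact quantum group: $C(\mathrm{SU}_q(2))$ is the universal unital $C^*$-algebra generated by $\alpha,\gamma$ with $\alpha^*\alpha+\gamma^*\gamma=\mathbb{1}$, $\alpha\alpha^*+q^2\gamma\gamma^*=\mathbb{1}$, $\gamma\gamma^*=\gamma^*\gamma$, $\alpha\gamma=q\gamma\alpha$, $\alpha\gamma^*=q\gamma^*\alpha$, with comultiplication $\Delta(\alpha)=\alpha\otimes\alpha-q\gamma^*\otimes\gamma$, $\Delta(\gamma)=\gamma\otimes\alpha+\alpha^*\otimes\gamma$. $h$ is its Haar state, with GNS map $\Lambda_h$ into $L^2(\mathbb{G})$. $\Gamma=\widehat{\mathrm{SU}_q(2)}$ is its dual in the Kustermans–Vaes sense, $L^2(\Gamma)=L^2(\mathbb{G})$. $P$ is the strictly positive selfadjoint operator on $L^2(\mathbb{G})$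 implementing the scaling groups; $P$ is the same for $\Gamma$ and for $\mathbb{G}$ and satisfies $P^{it}\Lambda_h(a)=\Lambda_h(\tau^{\mathbb{G}}_t(a))$ for $a\in C(\mathrm{SU}_q(2))$, $t\in\mathbb{R}$, where $(\tau^{\mathbb{G}}_t)$ is the scaling group of $\mathrm{SU}_q(2)$. Up to a Plancherel-null set, $\mathrm{Irr}(\Gamma)$ (the spectrum of $C(\mathrm{SU}_q(2))$) is identified with $\mathbb{T}$ through the representations $\psi^{2,\lambda}$ $(\lambda\in\mathbb{T})$ on $\mathsf{H}_\lambda=\ell^2(\mathbb{Z}_+)$ ($\mathbb{Z}_+=\{0,1,\dots\}$, orthonormal basis $(\phi_k)$): $\psi^{2,\lambda}(\alpha)\phi_k=\sqrt{1-q^{2k}}\,\phi_{k-1}$ (with $\phi_{-1}=0$), $\psi^{2,\lambda}(\gamma)\phi_k=\lambda q^k\phi_k$. The Plancherel measure $\mu$ is the normalized Lebesgue measure on $\mathbb{T}$, $D_\lambda=(1-q^2)^{-1/2}\mathrm{diag}(1,|q|^{-1},|q|^{-2},\dots)$, and $\mathcal{Q}_L:L^2(\mathbb{G})\to\int^\oplus\mathrm{HS}(\mathsf{H}_\lambda)d\mu(\lambda)$ is the unitary determined by $\mathcal{Q}_L\Lambda_h(a)=\int^\oplus\psi^{2,\lambda}(a)D_\lambda^{-1}d\mu(\lambda)$, $a\in C(\mathrm{SU}_q(2))$. All $\mathsf{H}_\lambda$ equal $\ell^2(\mathbb{Z}_+)$, so that $T_{\lambda'}$ makes sense in the fibre over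 $\lambda$. *)

(* Defs.v *)
From HB Require Import structures.
From mathcomp Require Import all_boot all_order all_algebra.
From mathcomp Require Import complex.
From mathcomp Require Import all_classical all_reals all_analysis.

Set Implicit Arguments.
Unset Strict Implicit.
Unset Printing Implicit Defensive.

Import Order.TTheory GRing.Theory Num.Theory.
Import numFieldNormedType.Exports.

Local Open Scope classical_set_scope.
Local Open Scope ring_scope.

(* The alias carries the structure of [numClosedFieldType] explicitly, so that
   the topology of a [numFieldType] is inferred on it. *)
Definition cplx (R : realType) : numClosedFieldType := R[i].

Definition rc {R : realType} (r : R) : cplx R := (r%:C)%C.

(* The norm of a complex normed module takes its values in [cplx R];
   [rnorm] is the same number as an element of [R]. *)
Definition rnorm {R : realType} {V : normedModType (cplx R)} (x : V) : R :=
  complex.Re `|x|.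

(******************************************************************************)
(* Hilbert spaces and operators. The inner product is linear on the left.     *)
(******************************************************************************)

HB.mixin Record CompleteNormedModule_isHilbert (R : realType) H
    & CompleteNormedModule (cplx R) H := {
  inner : H -> H -> cplx R ;
  innerPl : forall (a : cplx R) x y z,
    inner (a *: x + y) z = a * inner x z + inner y z ;
  innerC : forall x y, inner y x = Num.conj (inner x y) ;
  innerxx : forall x, inner x x = `|x| ^+ 2
}.

#[short(type="hilbertType")]
HB.structure Definition Hilbert (R : realType) :=
  {H of CompleteNormedModule (cplx R) H & CompleteNormedModule_isHilbert R H}.

Section hilbert.
Variables (R : realType) (H K : hilbertType R).

Definition bounded_op (T : H -> K) : Prop :=
  linear T /\ exists M : cplx R, forall x, `|T x| <= M * `|x|.

Definition unitary_op (U : H -> K) : Prop :=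
  [/\ linear U, forall x y, inner (U x) (U y) = inner x y
    & forall y, exists x, U x = y].

Definition is_adjoint (T : H -> K) (Ts : K -> H) : Prop :=
  forall x y, inner (T x) y = inner x (Ts y).

Definition orthonormal_basis (phi : nat -> H) : Prop :=
  (forall j k, inner (phi j) (phi k) = (j == k)%:R) /\
  forall x, series (fun k => inner x (phi k) *: phi k) @ \oo --> x.

End hilbert.

(* An unbounded operator: a domain, and a map that is meaningful on it. *)
Record unbounded_op (R : realType) (H : hilbertType R) := UnboundedOp {
  udom : set H ;
  uapp :> H -> H
}.

Section unbounded.
Variables (R : realType) (H : hilbertType R).
Implicit Type P : unbounded_op H.

Definition densely_defined P : Prop :=
  [/\ udom P 0,
      forall a x y, udom P x -> udom P y -> udom P (a *: x + y),
      forall a x y, udom P x -> udom P y -> P (a *: x + y) = a *: P x + P y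
    & closure (udom P) = setT].

(* The right-hand side of the equivalence is the graph of the adjoint. *)
Definition selfadjoint P : Prop :=
  densely_defined P /\
  forall y z, (udom P y /\ P y = z) <->
              (forall x, udom P x -> inner (P x) y = inner x z).

Definition strictly_positive P : Prop :=
  (forall x, udom P x -> 0 <= inner (P x) x) /\
  (forall x, udom P x -> P x = 0 -> x = 0).

(* [E] is a projection-valued measure on the Borel sets of [R];
   [m x] is the scalar measure [B |-> <E B x, x> = |E B x|^2]. *)
Definition projection_valued_measure
    (E : set R -> H -> H) (m : H -> {measure set R -> \bar R}) : Prop :=
  [/\ forall B, measurable B -> linear (E B),
      forall B x y, measurable B -> inner (E B x) y = inner x (E B y),
      forall B C x, measurable B -> measurable C ->
        E B (E C x) = E (B `&` C) x,
      forall x, E setT x = x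
    & forall B x, measurable B -> m x B = (rnorm (E B x) ^+ 2)%:E].

(* [P] is the integral of [s] over the half-line with respect to [E].
   The quadratic form of [P] on its domain determines [P] by polarization. *)
Definition spectral_resolution P
    (E : set R -> H -> H) (m : H -> {measure set R -> \bar R}) : Prop :=
  [/\ projection_valued_measure E m,
      forall x, E [set s | 0 < s] x = x,
      forall x, udom P x <->
        (\int[m x]_(s in [set s | 0 < s]%R) (s ^+ 2)%:E < +oo)%E
    & forall x, udom P x ->
        inner (P x) x = rc (\int[m x]_(s in [set s | 0 < s]) s)].

(* [U = P ^ (i t)] in the Borel functional calculus of a strictly positive
   selfadjoint [P]: the integral of [s ^ (i t) = exp (i t ln s)]. *)
Definition imaginary_power P (t : R) (U : H -> H) : Prop :=
  bounded_op U /\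
  exists E m, spectral_resolution P E m /\
    forall x, inner (U x) x =
      ((\int[m x]_(s in [set s | 0 < s]) cos (t * ln s))
       +i* (\int[m x]_(s in [set s | 0 < s]) sin (t * ln s)))%C.

End unbounded.

(******************************************************************************)
(* Unital C*-algebras                                                         *)
(******************************************************************************)

(* The product is part of the mixin: a structure inheriting both the rings and
   the normed modules of the library would need a join below [numDomainType]. *)
HB.mixin Record CompleteNormedModule_isCStar (R : realType) A
    & CompleteNormedModule (cplx R) A := {
  cstar1 : A ;
  cmul : A -> A -> A ;
  star : A -> A ;
  cmulA : associative cmul ;
  cmul1l : left_id cstar1 cmul ;
  cmul1r : right_id cstar1 cmul ;
  cmulPl : forall (a : cplx R) x y z,
    cmul (a *: x + y) z = a *: cmul x z + cmul y z ;
  cmulPr : forall (a : cplx R) x y z,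
    cmul x (a *: y + z) = a *: cmul x y + cmul x z ;
  starK : involutive star ;
  starP : forall (a : cplx R) x y,
    star (a *: x + y) = Num.conj a *: star x + star y ;
  starM : forall x y, star (cmul x y) = cmul (star y) (star x) ;
  cstar_normM : forall x y, `|cmul x y| <= `|x| * `|y| ;
  cstar_identity : forall x, `|cmul (star x) x| = `|x| ^+ 2
}.

#[short(type="cstarType")]
HB.structure Definition CStar (R : realType) :=
  {A of CompleteNormedModule (cplx R) A & CompleteNormedModule_isCStar R A}.

Notation "x ** y" := (cmul x y) (at level 40, left associativity) : ring_scope.


Section cstar.
Variable R : realType.

(* Contractivity is automatic for a *-homomorphism of C*-algebras. *)
Definition star_hom (A B : cstarType R) (f : A -> B) : Prop :=
  [/\ linear f, forall x y, f (x ** y) = f x ** f y, f cstar1 = cstar1,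
      forall x, f (star x) = star (f x) & forall x, `|f x| <= `|x|].

Definition star_rep (A : cstarType R) (H : hilbertType R)
    (rho : A -> H -> H) : Prop :=
  [/\ forall a, linear (rho a),
      forall (c : cplx R) a b x, rho (c *: a + b) x = c *: rho a x + rho b x,
      forall a b x, rho (a ** b) x = rho a (rho b x),
      forall x, rho cstar1 x = x
    & (forall a x y, inner (rho a x) y = inner x (rho (star a) y)) /\
      (forall a x, `|rho a x| <= `|a| * `|x|)].

Definition state (A : cstarType R) (h : A -> cplx R) : Prop :=
  [/\ forall (c : cplx R) a b, h (c *: a + b) = c * h a + h b,
      forall a, 0 <= h (star a ** a) & h cstar1 = 1].

Definition gns_map (A : cstarType R) (h : A -> cplx R) (H : hilbertType R)
    (Lambda : A -> H) : Prop :=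
  [/\ linear Lambda,
      forall a b, inner (Lambda a) (Lambda b) = h (star b ** a)
    & closure (range Lambda) = setT].

End cstar.

(******************************************************************************)
(* The compact quantum group SU_q(2)                                          *)
(******************************************************************************)

Section SUq2.
Variables (R : realType) (q : R).

Definition SUq2_relations (A : cstarType R) (alpha gamma : A) : Prop :=
  [/\ star alpha ** alpha + star gamma ** gamma = cstar1,
      alpha ** star alpha + rc (q ^+ 2) *: (gamma ** star gamma) = cstar1,
      gamma ** star gamma = star gamma ** gamma,
      alpha ** gamma = rc q *: (gamma ** alpha)
    & alpha ** star gamma = rc q *: (star gamma ** alpha)].

Variables (A : cstarType R) (alpha gamma : A).

(* The unital *-subalgebra generated by [alpha] and [gamma]. *)
Inductive PolSUq2 : A -> Prop :=
| Pol1 : PolSUq2 cstar1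
| Pol_alpha : PolSUq2 alpha
| Pol_gamma : PolSUq2 gamma
| Pol_star x : PolSUq2 x -> PolSUq2 (star x)
| PolP (c : cplx R) x y : PolSUq2 x -> PolSUq2 y -> PolSUq2 (c *: x + y)
| PolM x y : PolSUq2 x -> PolSUq2 y -> PolSUq2 (x ** y).

Definition universal_SUq2 : Prop :=
  [/\ SUq2_relations alpha gamma,
      closure [set x | PolSUq2 x] = setT
    & forall (B : cstarType R) (a c : B), SUq2_relations a c ->
        exists f : A -> B, [/\ star_hom f, f alpha = a & f gamma = c]].

(* Graph of the comultiplication [Pol -> Pol (x) Pol]: [comul x s] says that
   the sum of the [b (x) c] over the pairs [(b, c)] of [s] equals [Delta x].
   The rules say that [Delta] is a unital *-homomorphism with the prescribed
   values at the generators. An element has many representing sequences, so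
   [s] is only ever used through expressions bilinear in [(b, c)]. *)
Inductive comul : A -> seq (A * A) -> Prop :=
| comul1 : comul cstar1 [:: (cstar1, cstar1)]
| comul_alpha :
    comul alpha [:: (alpha, alpha); (- rc q *: star gamma, gamma)]
| comul_gamma : comul gamma [:: (gamma, alpha); (star alpha, gamma)]
| comul_star x s : comul x s ->
    comul (star x) [seq (star p.1, star p.2) | p <- s]
| comulZ (c : cplx R) x s : comul x s ->
    comul (c *: x) [seq (c *: p.1, p.2) | p <- s]
| comulD x y s t : comul x s -> comul y t -> comul (x + y) (s ++ t)
| comulM x y s t : comul x s -> comul y t ->
    comul (x ** y) [seq (p.1 ** r.1, p.2 ** r.2) | p <- s, r <- t].

(* Bi-invariance is stated on the dense *-subalgebra [Pol]; by continuity of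
   states it then holds on the whole C*-algebra. *)
Definition haar_state (h : A -> cplx R) : Prop :=
  state h /\
  forall x s, comul x s ->
    \sum_(p <- s) h p.1 *: p.2 = h x *: cstar1 /\
    \sum_(p <- s) h p.2 *: p.1 = h x *: cstar1.

Definition linear_on_Pol (V : lmodType (cplx R)) (f : A -> V) : Prop :=
  forall (c : cplx R) x y, PolSUq2 x -> PolSUq2 y ->
    f (c *: x + y) = c *: f x + f y.

(* [S] restricted to [Pol] is the antipode of the Hopf *-algebra [Pol];
   [eps] is its counit. *)
Definition antipode (S : A -> A) : Prop :=
  exists eps : A -> (cplx R)^o,
    [/\ linear_on_Pol S, linear_on_Pol eps,
        forall x s, comul x s ->
          \sum_(p <- s) eps p.1 *: p.2 = x /\
          \sum_(p <- s) eps p.2 *: p.1 = x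
      & forall x s, comul x s ->
          \sum_(p <- s) S p.1 ** p.2 = eps x *: cstar1 /\
          \sum_(p <- s) p.1 ** S p.2 = eps x *: cstar1].

(* Continuity of the derivative is automatic (Goursat). *)
Definition entire (V : completeNormedModType (cplx R))
    (F : (cplx R)^o -> V) : Prop :=
  exists dF : (cplx R)^o -> V,
    continuous dF /\ forall z : (cplx R)^o, is_derive z (1 : (cplx R)^o) F (dF z).

Definition one_parameter_automorphism_group (tau : R -> A -> A) : Prop :=
  [/\ forall t, star_hom (tau t),
      forall x, tau 0 x = x,
      forall s t x, tau (s + t) x = tau s (tau t x)
    & forall x, continuous (fun t => tau t x)].

(* The polar decomposition [S = R tau_(-i/2)] of the antipode, in the sense of
   Kustermans and Vaes: [Ru] is the unitary antipode, and [tauz] is the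
   analytic extension of [tau] to complex parameters on [Pol]. This
   decomposition determines [tau]. With [S = R tau_(i/2)], as Woronowicz has
   it, one gets the inverse group. *)
Definition scaling_group (tau : R -> A -> A) : Prop :=
  one_parameter_automorphism_group tau /\
  exists (Ru : A -> A) (tauz : cplx R -> A -> A),
    [/\ [/\ linear Ru, forall x y, Ru (x ** y) = Ru y ** Ru x,
            forall x, Ru (star x) = star (Ru x), involutive Ru
          & forall t x, Ru (tau t x) = tau t (Ru x)],
        forall x, PolSUq2 x -> PolSUq2 (Ru x),
        [/\ forall z x, PolSUq2 x -> PolSUq2 (tauz z x),
            forall t x, PolSUq2 x -> tauz (rc t) x = tau t x,
            forall z w x, PolSUq2 x -> tauz (z + w) x = tauz z (tauz w x)
          & forall x, PolSUq2 x -> entire (fun z => tauz z x)],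
        forall z x, PolSUq2 x -> Ru (tauz z x) = tauz z (Ru x)
      & antipode (fun x => Ru (tauz (0 -i* (2^-1))%C x))].

End SUq2.

(******************************************************************************)
(* The circle                                                                 *)
(******************************************************************************)

Definition circle (R : realType) := {z : cplx R | `|z| == 1}.

Section circle.
Variable R : realType.

Lemma norm_expi (x : R) : `|((cos x +i* sin x)%C : cplx R)| == 1.
Proof.
by apply/eqP; rewrite normc_def /= cos2Dsin2 sqrtr1.
Qed.

(* [exp (i x)] *)
Definition expi (x : R) : circle R :=
  exist _ ((cos x +i* sin x)%C : cplx R) (norm_expi x).

Lemma norm_circle_mul (z w : circle R) : `|sval z * sval w| == 1.
Proof. by rewrite normrM (eqP (svalP z)) (eqP (svalP w)) mulr1. Qed.

Definition circle_mul (z w : circle R) : circle R :=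
  exist _ (sval z * sval w) (norm_circle_mul z w).

(* [a ^ (i x)] for [a > 0] *)
Definition expi_base (a x : R) : circle R := expi (x * ln a).

HB.instance Definition _ := Choice.on (circle R).
HB.instance Definition _ := isPointed.Build (circle R) (expi 0).

(* A subset of the circle is Borel if and only if its preimage under [expi]
   is, because [expi] restricts to a Borel isomorphism on [[0, 2 pi[]. *)
Definition circle_measurable : set (set (circle R)) :=
  [set B | measurable (expi @^-1` B)].

Lemma circle_measurable0 : circle_measurable set0.
Proof. by rewrite /circle_measurable /= preimage_set0. Qed.

Lemma circle_measurableC B : circle_measurable B -> circle_measurable (~` B).
Proof.
by rewrite /circle_measurable /= preimage_setC => mB; exact: measurableC.
Qed.

Lemma circle_measurable_bigcup (F : (set (circle R))^nat) :
  (forall i, circle_measurable (F i)) -> circle_measurable (\bigcup_i (F i)).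
Proof.
rewrite /circle_measurable /= preimage_bigcup => mF.
exact: bigcup_measurable.
Qed.

HB.instance Definition _ := @isMeasurable.Build default_measure_display
  (circle R) circle_measurable circle_measurable0 circle_measurableC
  circle_measurable_bigcup.

Lemma measurable_expi : measurable_fun setT expi.
Proof. by move=> _ B mB; rewrite setTI. Qed.

Lemma two_pi_gt0 : (0 : R) < 2 * pi.
Proof. by rewrite mulr_gt0 // pi_gt0. Qed.

(* The normalized Lebesgue measure. *)
Definition circle_measure : set (circle R) -> \bar R :=
  pushforward (uniform_prob two_pi_gt0) expi.

HB.instance Definition _ := Measure.copy circle_measure
  (@measure_function_pushforward__canonical__measure_function_Measure
     _ _ _ _ _ (uniform_prob two_pi_gt0) _ measurable_expi).

End circle.

(******************************************************************************)
(* Direct integral of Hilbert-Schmidt operators over a constant field         *)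
(******************************************************************************)

Section direct_integral.
Context {d : measure_display} {X : measurableType d} {R : realType}.
Variables (mu : {measure set X -> \bar R}) (H : hilbertType R) (phi : nat -> H).

(* Squared Hilbert-Schmidt norm, computed in the orthonormal basis [phi]. *)
Definition hs_norm2 (T : H -> H) : \bar R :=
  (\sum_(0 <= k <oo) (rnorm (T (phi k)) ^+ 2)%:E)%E.

Definition hilbert_schmidt (T : H -> H) : Prop :=
  bounded_op T /\ (hs_norm2 T < +oo)%E.

Definition square_integrable_field (T : X -> H -> H) : Prop :=
  [/\ forall x, hilbert_schmidt (T x),
      forall j k,
        measurable_fun setT (fun x => complex.Re (inner (T x (phi j)) (phi k))) /\
        measurable_fun setT (fun x => complex.Im (inner (T x (phi j)) (phi k)))
    & (\int[mu]_x hs_norm2 (T x) < +oo)%E].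

(* The Hilbert space [K], with [cls T] for the class of the field [T], is the
   space of square-integrable fields modulo equality almost everywhere. The
   norm determines the inner product by polarization, and two fields have the
   same class if and only if they agree almost everywhere. The value of [cls]
   at a field that is not square-integrable is irrelevant. *)
Definition direct_integral_HS (K : hilbertType R)
    (cls : (X -> H -> H) -> K) : Prop :=
  [/\ forall (a : cplx R) S T,
        square_integrable_field S -> square_integrable_field T ->
        cls (fun x v => a *: S x v + T x v) = a *: cls S + cls T,
      forall T, square_integrable_field T ->
        (rnorm (cls T) ^+ 2)%:E = (\int[mu]_x hs_norm2 (T x))%E
    & forall y, exists2 T, square_integrable_field T & cls T = y].

End direct_integral.

(******************************************************************************)
(* Representations of C(SU_q(2)) on l^2 and Plancherel data                   *)
(******************************************************************************)

Section plancherel.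
Variables (R : realType) (q : R) (H : hilbertType R) (phi : nat -> H).

Definition psi2_rep (A : cstarType R) (alpha gamma : A) (lam : circle R)
    (rho : A -> H -> H) : Prop :=
  [/\ star_rep rho,
      forall k, rho alpha (phi k) =
        if k is j.+1 then rc (Num.sqrt (1 - q ^+ (2 * k))) *: phi j else 0
    & forall k, rho gamma (phi k) = (sval lam * rc (q ^+ k)) *: phi k].

(* The eigenvalue of [D] at [phi k]. *)
Definition D_eigenvalue (k : nat) : R :=
  (Num.sqrt (1 - q ^+ 2))^-1 * (`|q| ^+ k)^-1.

(* The inverse of the unbounded diagonal operator [D]. *)
Definition D_inverse (Dinv : H -> H) : Prop :=
  bounded_op Dinv /\ forall k, Dinv (phi k) = rc (D_eigenvalue k)^-1 *: phi k.

End plancherel.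

(* Main.v *)
Require Import Defs.
From HB Require Import structures.
From mathcomp Require Import all_boot all_order all_algebra.
From mathcomp Require Import complex.
From mathcomp Require Import all_classical all_reals all_analysis.
From mathcomp Require Import measurable_realfun.
From mathcomp Require Import ring lra.

Set Implicit Arguments.
Unset Strict Implicit.
Unset Printing Implicit Defensive.

Import Order.TTheory GRing.Theory Num.Theory.
Import numFieldNormedType.Exports.

Local Open Scope classical_set_scope.
Local Open Scope ring_scope.

(* Everything rests on S^2 = tau_(-i), so that tau_(-i) fixes alpha and multiplies
   gamma by q^2. For x in Pol with tau_(-i) x = r x, the function
   F(z) = Lambda (tau_z x) is entire, and F(z + t) = P^(it) F(z). The numerical
   range of P^(it) is in the unit disc, which forces the orbits of P^(it) on
   Lambda (Pol) to be isometric; differentiating the invariance of <F(z), F(w)>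
   under real translations then shows that <F(z + is), F(w)> = <F(z), F(w + is)>.
   Hence the Gram kernel of K(s) = r^s F(is) depends on a + b only and is
   1-periodic in it; positivity makes it midpoint convex, so it is constant, and
   F(is) = r^(-s) F(0). Thus F satisfies F' = i (ln r) F, which gives
   Lambda (tau_t alpha) = Lambda alpha and
   Lambda (tau_t gamma) = |q|^(2it) Lambda gamma.
   Applying Q_L, the representations psi_lambda o tau_t and
   psi_(lambda |q|^(2it)) agree on the generators for almost every lambda, hence
   on C(SU_q(2)). This is the claim on the dense subspace Lambda (C(SU_q(2))),
   and it extends because rotations preserve the Lebesgue measure. *)

(** * Complex scalars and real inner products *)

Section complex_scalars.
Variable R : realType.
Implicit Types (r s : R) (z w : cplx R).

Definition ic : cplx R := (0 +i* 1)%C.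

Lemma rcD r s : rc (r + s) = rc r + rc s.
Proof. exact: (rmorphD (real_complex R)). Qed.

Lemma rcN r : rc (- r) = - rc r.
Proof. exact: (rmorphN (real_complex R)). Qed.

Lemma rcB r s : rc (r - s) = rc r - rc s.
Proof. exact: (rmorphB (real_complex R)). Qed.

Lemma rcM r s : rc (r * s) = rc r * rc s.
Proof. exact: (rmorphM (real_complex R)). Qed.

Lemma rcX r n : rc (r ^+ n) = rc r ^+ n.
Proof. exact: (rmorphXn (real_complex R)). Qed.

Lemma rc0 : rc 0 = 0 :> cplx R. Proof. by []. Qed.

Lemma rc1 : rc 1 = 1 :> cplx R. Proof. by []. Qed.

Lemma rcV r : rc r^-1 = (rc r)^-1.
Proof. exact: (fmorphV (real_complex R)). Qed.

Lemma rc_inj : injective (@rc R).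
Proof. by move=> r s []. Qed.

Lemma rc_eq0 r : (rc r == 0) = (r == 0).
Proof. by apply/eqP/eqP => [[]|->]. Qed.

Lemma lec_rc r s : (rc r <= rc s) = (r <= s).
Proof. exact: lecR. Qed.

Lemma ltc_rc r s : (rc r < rc s) = (r < s).
Proof. exact: ltcR. Qed.

Lemma conj_rc r : Num.conj (rc r) = rc r.
Proof. by apply: conj_Creal; apply/complex_realP; exists r. Qed.

(** [Num.conj] is the abstract conjugation of a closed field. It sends the abstract root ['i] of -1
    to its opposite, and [ic] is ['i] or [- 'i], so it is sent to its opposite too. *)
Lemma conjcplxE z : Num.conj z = (complex.Re z -i* complex.Im z)%C :> cplx R.
Proof.
have iC : Num.conj (ic : cplx R) = - ic.
  have [/= j [j2 ji]] : exists j : cplx R, j ^+ 2 = -1 /\ Num.conj j = - j.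
    by exists 'i; rewrite sqrCi conjCi.
  have : (ic : cplx R) ^+ 2 == j ^+ 2.
    by rewrite j2 /ic expr2 /GRing.mul /= eq_complex /=; apply/andP; split;
       apply/eqP; ring.
  by rewrite eqf_sqr => /orP[] /eqP ->; rewrite ?rmorphN /= ji ?opprK.
have zE : z = rc (complex.Re z) + ic * rc (complex.Im z) by exact: complexE.
rewrite {1}zE rmorphD rmorphM /= !conj_rc iC.
by apply/eqP; rewrite eq_complex /=; apply/andP; split; apply/eqP; ring.
Qed.

Lemma normcplx_rc z : 0 <= z -> z = rc (complex.Re z).
Proof. by move=> z0; rewrite /rc RRe_real// ger0_real. Qed.

Lemma normrc r : `|rc r| = rc `|r|.
Proof. by rewrite normc_def /= expr0n/= addr0 sqrtr_sqr. Qed.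

Lemma ReD z w : complex.Re (z + w) = complex.Re z + complex.Re w.
Proof. by case: z; case: w. Qed.

Lemma ReN z : complex.Re (- z) = - complex.Re z.
Proof. by case: z. Qed.

Lemma ImD z w : complex.Im (z + w) = complex.Im z + complex.Im w.
Proof. by case: z; case: w. Qed.

Lemma ReM z w : complex.Re (z * w) =
  complex.Re z * complex.Re w - complex.Im z * complex.Im w.
Proof. by case: z; case: w. Qed.

Lemma ImM z w : complex.Im (z * w) =
  complex.Re z * complex.Im w + complex.Im z * complex.Re w.
Proof. by case: z; case: w. Qed.

End complex_scalars.
#[global] Arguments ic {R}.

Section real_norm.
Context {R : realType} {V : normedModType (cplx R)}.
Implicit Types (x y : V) (r : R).

Lemma rnormE x : `|x| = rc (rnorm x).
Proof. exact: (normcplx_rc (normr_ge0 x)). Qed.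

Lemma rnorm_ge0 x : 0 <= rnorm x.
Proof. rewrite -lec_rc -rnormE; exact: normr_ge0. Qed.

Lemma rnorm_eq0 x : (rnorm x == 0) = (x == 0).
Proof. by rewrite -rc_eq0 -rnormE normr_eq0. Qed.

Lemma rnorm0 : rnorm (0 : V) = 0.
Proof. by apply/eqP; rewrite rnorm_eq0. Qed.

Lemma rnormZ (c : cplx R) x : rnorm (c *: x) = complex.Re `|c| * rnorm x.
Proof.
apply: rc_inj; rewrite -rnormE normrZ rcM -rnormE.
by rewrite -(normcplx_rc (normr_ge0 c)).
Qed.

Lemma rnormD x y : rnorm (x + y) <= rnorm x + rnorm y.
Proof. by rewrite -lec_rc rcD -!rnormE ler_normD. Qed.

Lemma rnormN x : rnorm (- x) = rnorm x.
Proof. by rewrite /rnorm normrN. Qed.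

Lemma cvg_rnorm0 {T : Type} {F : set_system T} {FF : Filter F} (f : T -> V) :
  rnorm (f t) @[t --> F] --> (0 : R) -> f @ F --> 0.
Proof.
move=> f0; apply/cvgr0Pnorm_lt => e e0.
have eE := normcplx_rc (ltW e0); rewrite eE -rc0 ltc_rc in e0.
move/cvgr0Pnorm_lt/(_ _ e0) : f0; apply: filterS => t.
by rewrite ger0_norm ?rnorm_ge0// rnormE eE ltc_rc.
Qed.

Lemma cvg_rnorm {T : Type} {F : set_system T} {FF : Filter F} (f : T -> V) x :
  f @ F --> x -> rnorm (f t) @[t --> F] --> rnorm x.
Proof.
move=> fx; apply/cvgrPdist_lt => e e0.
have e0' : 0 < rc e by rewrite -rc0 ltc_rc.
move/cvgrPdist_lt/(_ _ e0'): fx; apply: filterS => t.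
rewrite rnormE ltc_rc; apply: le_lt_trans.
rewrite ler_norml; have := rnormD (x - f t) (f t).
have := rnormD (f t - x) x; rewrite !subrK -(rnormN (f t - x)) opprB; lra.
Qed.

Lemma cvgr_rnorm {T : Type} {F : set_system T} {FF : Filter F} (f : T -> V) x :
  f @ F --> x -> rnorm (f t - x) @[t --> F] --> (0 : R).
Proof.
move=> fx; rewrite -rnorm0; apply: cvg_rnorm.
by rewrite -[0](subrr x); apply: cvgB => //; exact: cvg_cst.
Qed.

Lemma closureT_approx (D : set V) x (e : R) : closure D = setT -> 0 < e ->
  exists2 y, D y & rnorm (y - x) < e.
Proof.
move=> Dd e0; have : closure D x by rewrite Dd.
have e0' : 0 < rc e by rewrite -rc0 ltc_rc.
move=> /(_ _ (nbhsx_ballx x _ e0')) [y [Dy]].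
rewrite -ball_normE /= rnormE ltc_rc => xy.
by exists y => //; rewrite -rnormN opprB.
Qed.

End real_norm.

Section inner_product.
Context {R : realType} {H : hilbertType R}.
Implicit Types (x y z : H) (a : cplx R).

Lemma innerDl x y z : inner (x + y) z = inner x z + inner y z.
Proof. by have := innerPl 1 x y z; rewrite scale1r mul1r. Qed.

Lemma inner0l z : inner 0 z = 0.
Proof. by apply: (addrI (inner 0 z)); rewrite -innerDl !addr0. Qed.

Lemma innerZl a x z : inner (a *: x) z = a * inner x z.
Proof. by have := innerPl a x 0 z; rewrite addr0 inner0l addr0. Qed.

Lemma innerNl x z : inner (- x) z = - inner x z.
Proof. by rewrite -scaleN1r innerZl mulN1r. Qed.

Lemma innerZr a x z : inner z (a *: x) = Num.conj a * inner z x.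
Proof. by rewrite innerC innerZl rmorphM/= -!innerC. Qed.

Lemma inner0r z : inner z 0 = 0.
Proof. by rewrite innerC inner0l rmorph0. Qed.

(** The real inner product underlying the complex one. Being real valued, it carries all the
    differentiation; a factor [ic] in one argument recovers the imaginary part. *)
Definition inr x y : R := complex.Re (inner x y).

Lemma inrC x y : inr x y = inr y x.
Proof. by rewrite /inr innerC conjcplxE. Qed.

Lemma inrDl x y z : inr (x + y) z = inr x z + inr y z.
Proof. by rewrite /inr innerDl ReD. Qed.

Lemma inrNl x z : inr (- x) z = - inr x z.
Proof. by rewrite /inr innerNl ReN. Qed.

Lemma inrZl (r : R) x z : inr (rc r *: x) z = r * inr x z.
Proof. by rewrite /inr innerZl ReM /= mul0r subr0. Qed.

Lemma inrDr x y z : inr z (x + y) = inr z x + inr z y.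
Proof. by rewrite inrC inrDl !(inrC z). Qed.

Lemma inrNr x z : inr z (- x) = - inr z x.
Proof. by rewrite inrC inrNl (inrC z). Qed.

Lemma inrZr (r : R) x z : inr z (rc r *: x) = r * inr z x.
Proof. by rewrite inrC inrZl (inrC z). Qed.

Definition inrE := (inrDl, inrNl, inrZl, inrDr, inrNr, inrZr).

Lemma inr_icl x y : inr (ic *: x) y = - complex.Im (inner x y).
Proof. by rewrite /inr innerZl ReM /= mul0r mul1r add0r. Qed.

Lemma inr_icr x y : inr x (ic *: y) = complex.Im (inner x y).
Proof.
by rewrite inrC inr_icl innerC conjcplxE /= opprK.
Qed.

Lemma inr_ic x y : inr (ic *: x) (ic *: y) = inr x y.
Proof. by rewrite inr_icl innerZr conjcplxE ImM /= mul0r add0r mulN1r opprK. Qed.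

Lemma inrxx x : inr x x = rnorm x ^+ 2.
Proof. by rewrite /inr innerxx rnormE -rcX. Qed.

Lemma inrxx_eq0 x : inr x x = 0 -> x = 0.
Proof. by rewrite inrxx => /eqP; rewrite sqrf_eq0 rnorm_eq0 => /eqP. Qed.

Lemma inr_ext x y : (forall z, inr x z = inr y z) -> x = y.
Proof.
move=> xy; apply/eqP; rewrite -subr_eq0; apply/eqP/inrxx_eq0.
by rewrite inrDl inrNl xy subrr.
Qed.

(** Reduces continuity and invariance of inner products to those of norms. *)
Lemma inr_polar x y :
  inr x y = 4^-1 * (rnorm (x + y) ^+ 2 - rnorm (x - y) ^+ 2).
Proof. by rewrite -!inrxx !inrE (inrC y x); field. Qed.

Lemma cvg_inr {T : Type} {F : set_system T} {FF : Filter F} (f g : T -> H) x y :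
  f @ F --> x -> g @ F --> y -> inr (f t) (g t) @[t --> F] --> inr x y.
Proof.
move=> fx gy.
under eq_cvg do rewrite inr_polar.
rewrite inr_polar; apply: cvgMr; apply: cvgB; apply: cvgM => //.
- by apply: cvg_rnorm; apply: cvgD.
- by apply: cvg_rnorm; apply: cvgD.
- by apply: cvg_rnorm; apply: cvgB.
- by apply: cvg_rnorm; apply: cvgB.
Qed.

Lemma inner_ext x y : (forall z, inner x z = inner y z) -> x = y.
Proof. by move=> xy; apply: inr_ext => z; rewrite /inr xy. Qed.

End inner_product.

(** * Entire orbits *)

Section linear_functions.
Context {R : realType}.

Lemma linear_fun0 (V W : lmodType (cplx R)) (f : V -> W) : linear f -> f 0 = 0.
Proof.
move=> lf; have := lf 1 0 0; rewrite !scale1r addr0 => f00.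
by apply: (addrI (f 0)); rewrite addr0 -f00.
Qed.

Lemma linear_funZ (V W : lmodType (cplx R)) (f : V -> W) (c : cplx R) x :
  linear f -> f (c *: x) = c *: f x.
Proof. by move=> lf; have := lf c x 0; rewrite !addr0 linear_fun0// addr0. Qed.

Lemma linear_funD (V W : lmodType (cplx R)) (f : V -> W) x y :
  linear f -> f (x + y) = f x + f y.
Proof. by move=> lf; have := lf 1 x y; rewrite !scale1r. Qed.

Lemma linear_funB (V W : lmodType (cplx R)) (f : V -> W) x y :
  linear f -> f (x - y) = f x - f y.
Proof.
by move=> lf; have := lf (-1) y x; rewrite !scaleN1r [- y + x]addrC [- f y + _]addrC.
Qed.

End linear_functions.

Section real_derivative.
Context {R : realType} {H : hilbertType R}.
Implicit Types (f g : R -> H) (x y D E : H).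

(* The derivative of a curve parametrized by the reals. The derivatives of the
   library do not apply, because [H] is a normed module over [cplx R] only. *)
Definition rderiv f (t : R) D :=
  (rc h)^-1 *: (f (h + t) - f t) @[h --> (0 : R)^'] --> D.

Lemma cvg_rc {T : Type} {F : set_system T} {FF : Filter F} (u : T -> R) (r : R) :
  u @ F --> r -> (rc (u t) : (cplx R)^o) @[t --> F] --> (rc r : (cplx R)^o).
Proof.
move=> ur; apply/cvgrPdist_lt => e e0.
have eE := normcplx_rc (ltW e0); rewrite eE -rc0 ltc_rc in e0.
move/cvgrPdist_lt/(_ _ e0) : ur; apply: filterS => t.
by rewrite -rcB [X in _ -> X < _]normrc [X in _ -> _ < X]eE ltc_rc.
Qed.

Lemma cvg_near_eq {T : Type} {V : topologicalType} {F : set_system T}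
    {FF : Filter F} (u v : T -> V) (l : set_system V) :
  u @ F --> l -> (\forall t \near F, u t = v t) -> v @ F --> l.
Proof. by move=> ul uv; apply: cvg_trans ul; exact/near_eq_cvg. Qed.

Lemma rderiv_cvg f t D : rderiv f t D -> f (h + t) @[h --> (0 : R)^'] --> f t.
Proof.
move=> fD.
have h0 : (rc h : (cplx R)^o) @[h --> (0 : R)^'] --> (rc 0 : (cplx R)^o).
  by apply: cvg_rc; exact: cvg_within.
pose proof (cvgD (cvgZ h0 fD) (cvg_cst (f t))) as lim; move: lim.
rewrite rc0 scale0r add0r; move/cvg_near_eq; apply; near=> h.
have h_neq0 : rc h != 0 by rewrite rc_eq0; near: h; exact: nbhs_dnbhs_neq.
by rewrite /= fctE scalerA divff// scale1r subrK.
Unshelve. all: by end_near. Qed.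

Lemma rderiv_inr f g t D E : rderiv f t D -> rderiv g t E ->
  is_derive t (1 : R) (fun s => inr (f s) (g s)) (inr D (g t) + inr (f t) E).
Proof.
move=> fD gE.
have cv : h^-1 *: (inr (f (h *: (1 : R) + t)) (g (h *: (1 : R) + t))
            - inr (f t) (g t)) @[h --> (0 : R)^'] --> inr D (g t) + inr (f t) E.
  (* The increment is split by moving [f] and [g] one after the other; the quotient of [f] is paired
     with [g (h + t)], which tends to [g t]. *)
  pose proof (cvgD (cvg_inr fD (rderiv_cvg gE)) (cvg_inr (cvg_cst (f t)) gE)) as lim; move: lim.
  move/cvg_near_eq; apply; near=> h.
  rewrite ?fctE /= -!rcV [h *: 1]mulr1 !inrE /GRing.scale/=; ring.
apply: DeriveDef; first exact: cvgP cv.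
by apply: cvg_lim cv; exact: Rhausdorff.
Unshelve. all: by end_near. Qed.

Lemma rderiv_cst x t : rderiv (fun=> x) t 0.
Proof. by rewrite /rderiv subrr; under eq_cvg do rewrite scaler0; exact: cvg_cst. Qed.

Lemma rderivD f g t D E : rderiv f t D -> rderiv g t E ->
  rderiv (fun s => f s + g s) t (D + E).
Proof.
move=> fD gE; pose proof (cvgD fD gE) as lim; move: lim => /cvg_near_eq; apply; near=> h.
by rewrite ?fctE -scalerDr; congr (_ *: _); rewrite opprD addrACA.
Unshelve. all: by end_near. Qed.

Lemma rderivZ (c : cplx R) f t D : rderiv f t D ->
  rderiv (fun s => c *: f s) t (c *: D).
Proof.
move=> fD; pose proof (cvgZ (cvg_cst c) fD) as lim; move: lim => /cvg_near_eq; apply; near=> h.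
by rewrite ?fctE /= -scalerBr !scalerA mulrC.
Unshelve. all: by end_near. Qed.

Lemma rderiv_line (F : (cplx R)^o -> H) (z c : cplx R) (t : R) D : c != 0 ->
  is_derive (z + rc t * c : (cplx R)^o) (1 : (cplx R)^o) F D ->
  rderiv (fun s => F (z + rc s * c)) t (c *: D).
Proof.
move=> c0 [dF FD].
(* As the real [h] tends to 0, [rc h * c] tends to 0 without vanishing, so it may serve as the
   complex increment; the outer factor [c] then reduces its inverse to that of [rc h]. *)
have rc_dnbhs : (rc h * c : (cplx R)^o) @[h --> (0 : R)^'] --> (0 : (cplx R)^o)^'.
  have h0 : (rc h : (cplx R)^o) @[h --> (0 : R)^'] --> (rc 0 : (cplx R)^o).
    by apply: cvg_rc; exact: cvg_within.
  pose proof (cvgM h0 (@cvg_cst _ (c : (cplx R)^o) _ (0 : R)^' _)) as lim.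
  rewrite rc0 mul0r in lim.
  move=> P P0.
  have hP : \forall h \near (0 : R)^', rc h * c != 0 -> P (rc h * c) := lim _ P0.
  change (\forall h \near (0 : R)^', P (rc h * c)); near=> h.
  have hc0 : rc h * c != 0.
    by rewrite mulf_neq0// rc_eq0; near: h; exact: nbhs_dnbhs_neq.
  by move: hc0; near: h.
pose proof (cvgZ (cvg_cst c) (cvg_comp _ _ rc_dnbhs dF)) as lim; move: lim.
rewrite -/(derive F _ _) FD; move/cvg_near_eq; apply; near=> h.
rewrite ?fctE /= scalerA invfM mulrCA mulfV// mulr1; congr (_ *: (F _ - _)).
by rewrite [_ *: 1]mulr1 rcD mulrDl addrCA.
Unshelve. all: by end_near. Qed.

End real_derivative.

(** * Isometric orbits and their analytic continuation *)

Section unitary_orbits.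
Context {R : realType} {H : hilbertType R}.

(** For fixed [t], the bound says that [s |-> inr (g s) (g t)] is maximal at [s = t]. Hence
    [inr (dg t) (g t) = 0], and the squared norm has derivative zero. *)
Lemma rnorm_orbit (g dg : R -> H) :
  (forall t, rderiv g t (dg t)) ->
  (forall t s, inr (g (s + t)) (g t) <= rnorm (g t) ^+ 2) ->
  forall t, rnorm (g t) = rnorm (g 0).
Proof.
move=> gD gle.
have dg0 t : inr (dg t) (g t) = 0.
  have dD s : is_derive s (1 : R) (fun s => inr (g s) (g t)) (inr (dg s) (g t)).
    have := rderiv_inr (gD s) (rderiv_cst (g t) s).
    by rewrite /inr inner0r addr0.
  have [] := @derive1_at_max R (fun s => inr (g s) (g t)) (t - 1) (t + 1) t.
  - lra.
  - by move=> s _; have [] := dD s.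
  - by rewrite in_itv/=; apply/andP; split; lra.
  - by move=> s _; rewrite inrxx; have := gle t (s - t); rewrite subrK.
  - by move=> _ <-; have [_ ->] := dD t.
move=> t; apply/eqP; rewrite -(eqrXn2 (ltn0Sn 1)) ?rnorm_ge0//; apply/eqP.
rewrite -!inrxx; apply: (is_derive_0_is_cst (f := fun t => inr (g t) (g t))).
move=> s; have := rderiv_inr (gD s) (gD s).
by rewrite dg0 inrC dg0 addr0.
Qed.

(* As a Gram kernel, [Psi] is midpoint convex; being periodic and continuous, it
   attains its maximum, and midpoint convexity around that point is an equality. *)
Lemma gram_periodic_cst (K : R -> H) (Psi : R -> R) :
  (forall a b, inr (K a) (K b) = Psi (a + b)) ->
  (forall s, Psi (s - 1) = Psi s) -> continuous Psi -> forall a, K a = K 0.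
Proof.
move=> KPsi PsiP cPsi.
have PsiPn (n : nat) s : Psi (s - n%:R) = Psi s.
  by elim: n s => [|n IH] s; rewrite ?subr0// -natr1 opprD addrA PsiP.
have PsiPz (n : int) s : Psi (s - n%:~R) = Psi s.
  case: n => n; first exact: PsiPn.
  by rewrite NegzE mulrNz opprK -[RHS](PsiPn n.+1) ?addrK -[LHS](PsiPn n.+1) addrK.
have [||c _ Psimax] := @EVT_max R Psi 0 1.
- exact: ler01.
- exact: continuous_subspaceT.
have {}Psimax s : Psi s <= Psi c.
  rewrite -(PsiPz (Num.floor s)); apply: Psimax; rewrite in_itv/=.
  rewrite subr_ge0 ge_floor/= lerBlDr addrC.
  by apply: ltW; rewrite -intrD1 floorD1_gt.
have dK a b : rnorm (K a - K b) ^+ 2 = Psi (a + a) + Psi (b + b) - 2 * Psi (a + b).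
  by rewrite -inrxx !inrE !KPsi (addrC b a); ring.
(* The points [(c + h) / 2] and [(c - h) / 2] have sum [c], so [dK] gives
   [2 * Psi c <= Psi (c + h) + Psi (c - h)], while each term on the right is at most [Psi c]. *)
have Psicst h : Psi (c + h) = Psi c.
  have := dK ((c + h) / 2) ((c - h) / 2).
  rewrite -!splitr (_ : (c + h) / 2 + (c - h) / 2 = c); last by field.
  have := sqr_ge0 (rnorm (K ((c + h) / 2) - K ((c - h) / 2))).
  have := Psimax (c - h); have := Psimax (c + h); lra.
move=> a; apply/eqP; rewrite -subr_eq0 -rnorm_eq0 -sqrf_eq0 dK; apply/eqP.
have Psic s : Psi s = Psi c by rewrite -(Psicst (s - c)) addrC subrK.
by rewrite !(Psic (_ + _)); ring.
Qed.

Section entire_orbit.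
Variables (F dF : (cplx R)^o -> H) (U : R -> H -> H).
Hypothesis F_deriv : forall z, is_derive z (1 : (cplx R)^o) F (dF z).
Hypothesis U_linear : forall s, linear (U s).
Hypothesis FU : forall s (z : cplx R), F (z + rc s) = U s (F z).
Hypothesis U_le : forall s x, inr (U s x) x <= rnorm x ^+ 2.

Let F_rderiv (z c : cplx R) (t : R) : c != 0 ->
  rderiv (fun s => F (z + rc s * c)) t (c *: dF (z + rc t * c)).
Proof. by move=> c0; apply: rderiv_line. Qed.

Let F_rderiv1 (z : cplx R) (t : R) :
  rderiv (fun s => F (z + rc s)) t (dF (z + rc t)).
Proof.
have := @F_rderiv z 1 t (oner_neq0 _); rewrite scale1r mulr1.
by rewrite (_ : (fun s => F (z + rc s * 1)) = (fun s => F (z + rc s)))//;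
   apply/funext => s; rewrite mulr1.
Qed.

Lemma ic_neq0 : ic != 0 :> cplx R.
Proof. by apply/eqP => -[] /eqP; rewrite oner_eq0. Qed.

(** By linearity of [U], a linear combination of two orbits is again an orbit. Combinations, rather
    than single orbits, are what polarization requires. *)
Lemma entire_orbit_rnorm (c z w : cplx R) (t : R) :
  rnorm (c *: F (z + rc t) + F (w + rc t)) = rnorm (c *: F z + F w).
Proof.
have /= := @rnorm_orbit (fun t => c *: F (z + rc t) + F (w + rc t))
  (fun t => c *: dF (z + rc t) + dF (w + rc t)).
rewrite rc0 !addr0; apply => [s|s r].
  by apply: rderivD; [apply: rderivZ|]; exact: F_rderiv1.
by rewrite (addrC r) rcD !addrA !(FU r) -U_linear; exact: U_le.
Qed.

Lemma entire_orbit_inr_ic (z w : cplx R) (t : R) :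
  inr (ic *: F (z + rc t)) (F (w + rc t)) = inr (ic *: F z) (F w).
Proof.
have rnN x y : rnorm (ic *: x - y) = rnorm (- ic *: x + y) :> R.
  by rewrite -rnormN opprB addrC scaleNr.
by rewrite !inr_polar !rnN !entire_orbit_rnorm.
Qed.

(** Derivative at 0 of the constant function in [entire_orbit_inr_ic]. The factor [ic] is there
    because moving in the imaginary direction differentiates [F] to [ic *: dF]. *)
Lemma entire_orbit_skew (z w : cplx R) :
  inr (ic *: dF z) (F w) + inr (ic *: F z) (dF w) = 0.
Proof.
have := rderiv_inr (rderivZ (c:=ic) (@F_rderiv1 z 0)) (@F_rderiv1 w 0).
rewrite (_ : (fun s => _) = cst (inr (ic *: F z) (F w))); last first.
  by apply/funext => s; exact: entire_orbit_inr_ic.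
by rewrite rc0 !addr0 => -[_ <-]; rewrite derive_cst.
Qed.

Lemma entire_orbit_gram (z w : cplx R) (t : R) :
  inr (F (z + rc t * ic)) (F w) = inr (F z) (F (w + rc t * ic)).
Proof.
(* [phi] moves the imaginary translation from one argument to the other: [s = 0] gives the
   right-hand side and [s = t] the left-hand side. Its derivative vanishes by
   [entire_orbit_skew]. *)
pose phi s := inr (F (z + rc s * ic)) (F (w + rc t * ic + rc s * (- ic))).
have <- : phi t = inr (F (z + rc t * ic)) (F w) by rewrite /phi mulrN addrK.
have <- : phi 0 = inr (F z) (F (w + rc t * ic)).
  by rewrite /phi rc0 !mul0r !addr0.
apply: is_derive_0_is_cst => s.
have icN0 : - (ic : cplx R) != 0 by rewrite oppr_eq0 ic_neq0.
have := rderiv_inr (@F_rderiv z ic s ic_neq0)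
                   (@F_rderiv (w + rc t * ic) (- ic) s icN0).
rewrite -/phi scaleNr inrNr inr_icr -[complex.Im _]opprK -inr_icl opprK.
by rewrite entire_orbit_skew.
Qed.

Variable r : R.
Hypothesis r_gt0 : 0 < r.
Hypothesis F_eigen : F (- ic) = rc r *: F 0.

Let l := ln r.

Lemma entire_orbit_imag (s : R) : F (rc s * ic) = rc (expR (- (l * s))) *: F 0.
Proof.
(* The scalar is [r ^ s]. It gives [K (-1) = K 0] by [F_eigen], whence the period 1 of [Psi]. *)
pose K s := rc (expR (l * s)) *: F (rc s * ic).
pose Psi s := expR (l * s) * inr (F (rc s * ic)) (F 0).
have F00 : F (rc 0 * ic) = F 0 by rewrite rc0 mul0r.
have KPsi a b : inr (K a) (K b) = Psi (a + b).
  rewrite /K /Psi !inrE mulrA -expRD -mulrDr; congr (_ * _).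
  have := entire_orbit_gram 0 (rc b * ic) a; rewrite add0r => ->.
  have := entire_orbit_gram 0 0 (a + b); rewrite !add0r => ->.
  by rewrite rcD mulrDl addrC.
have K0 : K 0 = F 0 by rewrite /K mulr0 expR0 scale1r F00.
have KN1 : K (-1) = F 0.
  rewrite /K mulrN1 expRN lnK ?posrE// rcN mulN1r F_eigen scalerA -rcM.
  by rewrite mulVf ?gt_eqF// scale1r.
have PsiK s' : Psi s' = inr (K s') (F 0) by rewrite -K0 KPsi addr0.
have KE : K s = K 0.
  apply: (gram_periodic_cst KPsi) => [s'|s'].
    by rewrite -KPsi KN1 PsiK.
  apply: (@differentiable_continuous _ R^o R^o); apply/derivable1_diffP.
  apply: derivableM; last first.
    have := rderiv_inr (@F_rderiv 0 ic s' ic_neq0) (rderiv_cst (F 0) s').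
    under [X in is_derive _ _ X]eq_fun do rewrite add0r.
    by case.
  by [].
rewrite -[LHS]scale1r -rc1 -(expR0 R) -(addNr (l * s)) expRD rcM -scalerA.
by rewrite -[_ *: F _]/(K s) KE K0.
Qed.

(** Linearity of [U] carries [entire_orbit_imag] over to the vertical line through [t]. The
    imaginary derivative there is [ic *: dF (rc t)] on one side and [- (rc l *: F (rc t))] on the
    other. *)
Lemma entire_orbit_ode (t : R) : dF (rc t) = (rc l * ic) *: F (rc t).
Proof.
suff icdF : ic *: dF (rc t) = - (rc l *: F (rc t)).
  have ic2 : - (ic * ic) = 1 :> cplx R.
    by apply/eqP; rewrite eq_complex /=; apply/andP; split; apply/eqP; ring.
  have -> : dF (rc t) = - (ic *: (ic *: dF (rc t))).
    by rewrite scalerA -scaleNr ic2 scale1r.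
  by rewrite icdF scalerN opprK scalerA mulrC.
have FE s : F (rc t + rc s * ic) = rc (expR (- (l * s))) *: F (rc t).
  by rewrite addrC FU entire_orbit_imag (linear_funZ _ _ (U_linear t)) -FU add0r.
apply: inr_ext => w.
have := rderiv_inr (@F_rderiv (rc t) ic 0 ic_neq0) (rderiv_cst w 0).
rewrite /= rc0 mul0r addr0 [X in _ + X]/inr inner0r addr0.
rewrite (_ : (fun s => _) =
  (fun s => expR (- (l * s)) * inr (F (rc t)) w)); last first.
  by apply/funext => s; rewrite FE inrZl.
move=> -[_ <-].
have dr : is_derive (0 : R) (1 : R) (fun s => expR (- (l * s)) * inr (F (rc t)) w)
    (- l * inr (F (rc t)) w).
  apply: is_derive_eq; rewrite !mulr0 oppr0 expR0 /GRing.scale/=; ring.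
by have [_ ->] := dr; rewrite !inrE mulNr.
Qed.

Theorem entire_orbit_eigen (t : R) :
  F (rc t) = sval (expi (t * l)) *: F 0.
Proof.
have dF0 s w : is_derive s (1 : R) (fun s => inr (F (rc s)) w)
    (- l * inr (F (rc s)) (ic *: w)).
  have := rderiv_inr (@F_rderiv1 0 s) (rderiv_cst w s).
  rewrite (_ : (fun s => _) = (fun s => inr (F (rc s)) w)); last first.
    by apply/funext => s'; rewrite add0r.
  rewrite /= add0r entire_orbit_ode [X in _ + X]/inr inner0r addr0 -scalerA.
  by rewrite inrZl inr_icl -inr_icr mulrN mulNr.
(* [G s] is the real inner product of [F (rc s)] with the expected solution [expi (s * l) *: F 0].
   By the differential equation it is constant; as both vectors have the norm of [F 0], their
   distance is zero. *)
pose G s := inr (F (rc s)) (F 0) * cos (s * l) + inr (F (rc s)) (ic *: F 0) * sin (s * l).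
have G0 : G t = rnorm (F 0) ^+ 2.
  have -> : G t = G 0.
    apply: is_derive_0_is_cst => s.
    apply: is_derive_eq.
    rewrite scalerA (_ : ic * ic = -1 :> cplx R); last first.
      by apply/eqP; rewrite eq_complex /=; apply/andP; split; apply/eqP; ring.
    by rewrite scaleN1r inrNr /GRing.scale /=; ring.
  by rewrite /G !mul0r cos0 sin0 mulr1 mulr0 addr0 inrxx.
have Ft : rnorm (F (rc t)) = rnorm (F 0).
  by have := entire_orbit_rnorm 0 0 0 t; rewrite !scale0r !add0r.
have eE : sval (expi (t * l)) = rc (cos (t * l)) + rc (sin (t * l)) * ic :> cplx R.
  by apply/eqP; rewrite eq_complex /=; apply/andP; split; apply/eqP; ring.
apply/eqP; rewrite -subr_eq0; apply/eqP/inrxx_eq0.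
rewrite eE scalerDl -scalerA !inrE inr_ic (inrC (F 0) (F (rc t))).
rewrite (inrC (ic *: F 0) (F (rc t))) !inrxx Ft.
have icFF : inr (F 0) (ic *: F 0) = 0.
  by rewrite inr_icr innerxx rnormE -rcX.
rewrite ?(inrC (ic *: F 0) (F 0)) icFF.
have cs := cos2Dsin2 (t * l); rewrite /G in G0.
set a := inr _ _ in G0 *; set b := inr _ _ in G0 *.
rewrite [X in X = _](_ : _ = rnorm (F 0) ^+ 2 * (1 + (cos (t * l) ^+ 2 + sin (t * l) ^+ 2))
  - 2 * (a * cos (t * l) + b * sin (t * l))); last by ring.
by rewrite cs G0; ring.
Qed.

End entire_orbit.
End unitary_orbits.

(** * Rotations of the circle *)

Section translation.
Context {R : realType}.
Local Notation mu := (@lebesgue_measure R).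

Lemma measurable_addr (a : R) :
  measurable_fun setT (fun x : measurableTypeR R => x + a : measurableTypeR R).
Proof. by apply: measurable_funD => //; exact: measurable_cst. Qed.

Lemma lebesgue_measure_translation (a : R) (A : set R) : measurable A ->
  pushforward mu (fun x : measurableTypeR R => x + a : measurableTypeR R) A = mu A.
Proof.
move=> mA; apply/esym/lebesgue_measure_unique => //=.
  exact: measurable_addr.
move=> ? _ [[c d]] _ <-.
rewrite /pushforward /=.
rewrite (_ : _ @^-1` _ = `]c - a, d - a]%classic); last first.
  by apply/seteqP; split => x /=; rewrite !in_itv/= ltrBlDr lerBrDr.
by rewrite !lebesgue_measure_itv/= !lte_fin ltrD2r -!EFinD opprB addrA subrK.
Qed.

Lemma ge0_integral_translation (a : R) (D : set R) (f : R -> \bar R) :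
  measurable D -> measurable_fun [set: R] f -> (forall x, (0 <= f x)%E) ->
  (\int[mu]_(x in [set x | D (x + a)%R]) f (x + a)%R = \int[mu]_(x in D) f x)%E.
Proof.
move=> mD mf f0.
have mfD : measurable_fun D f by exact: measurable_funS mf.
have := @ge0_integral_pushforward _ _ _ _ R _ (measurable_addr a) mu D f mD mfD.
rewrite -[X in (_ -> _ = X) -> _]/(\int[mu]_(x in [set x | D (x + a)%R]) f (x + a)%R)%E.
move=> <- //; apply: eq_measure_integral; first exact: measurable_addr.
by move=> ? A mA _; exact: lebesgue_measure_translation.
Qed.

End translation.

Section circle_rotation.
Context {R : realType}.
Local Notation mu := (@lebesgue_measure R).

Lemma circle_mul_expi (x y : R) : circle_mul (expi x) (expi y) = expi (x + y).
Proof.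
apply: val_inj; rewrite /= cosD sinD.
by apply/eqP; rewrite eq_complex /=; apply/andP; split; apply/eqP; ring.
Qed.

Lemma expiD2pi (x : R) : expi (x + 2 * pi) = expi x.
Proof.
by apply: val_inj; rewrite /= mulr_natl cosD2pi sinD2pi.
Qed.

Lemma measurable_circle_mul (y : R) :
  measurable_fun setT (fun z : circle R => circle_mul z (expi y)).
Proof.
move=> _ B mB; rewrite setTI.
rewrite /measurable /= /circle_measurable /= -comp_preimage.
rewrite (_ : _ \o _ = @expi R \o (fun x => x + y)); last first.
  by apply/funext => x /=; rewrite circle_mul_expi.
by rewrite comp_preimage -[X in measurable X]setTI; exact: measurable_addr.
Qed.

Section periodic.
Variable g : R -> \bar R.
Hypothesis mg : measurable_fun [set: R] g.
Hypothesis g0 : forall x, (0 <= g x)%E.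
Hypothesis gP : forall x, g (x + 2 * pi) = g x.

Let I (a : R) : \bar R := (\int[mu]_(x in `]a, (a + 2 * pi)%R]) g x)%E.

(** Two intervals of length one period overlap when the shift is at most a period. The two pieces
    outside the overlap are translates of each other by [2 * pi]. *)
Lemma integral_period_step (a s : R) : 0 <= s <= 2 * pi -> I (a + s) = I a.
Proof.
move=> /andP[s0 s2pi]; rewrite /I.
have mg' D : measurable D -> measurable_fun D g by move=> ?; exact: measurable_funS mg.
have split_itv (u v w : R) : u <= v -> v <= w ->
  `]u, w]%classic = `]u, v] `|` `]v, w] :> set R.
  by move=> uv vw; rewrite -itv_bndbnd_setU// bnd_simp.
have dis (u v w : R) : [disjoint `]u, v] & `]v, w]].
  apply/disj_setPS => x [] /=; rewrite !in_itv/= => /andP[_ xv] /andP[vx _].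
  by have := le_lt_trans xv vx; rewrite ltxx.
rewrite (split_itv (a + s) (a + 2 * pi) (a + s + 2 * pi)); [|lra|lra].
rewrite [in RHS](split_itv a (a + s) (a + 2 * pi)); [|lra|lra].
rewrite !ge0_integral_setU//; do ?[exact: dis|by apply: mg'; exact: measurableU].
rewrite addeC; congr (_ + _)%E.
rewrite -(ge0_integral_translation (2 * pi) (D := `]a + 2 * pi, a + s + 2 * pi]))//.
congr (integral _ _ _); last exact/funext.
by apply/seteqP; split => x /=; rewrite !in_itv/= ltrD2r lerD2r.
Qed.

Lemma integral_period (a b : R) : I a = I b.
Proof.
suff ID u v : 0 <= v -> I (u + v) = I u.
  have [ab|/ltW ba] := leP a b; first by rewrite -(ID a (b - a)) ?subr_ge0// addrC subrK.
  by rewrite -(ID b (a - b)) ?subr_ge0// addrC subrK.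
move=> v0; have pi0 := two_pi_gt0 R.
(* The shift [v] is cut into [n.+1] equal steps, enough for each to be at most one period. *)
pose n := Num.bound (v / (2 * pi)); pose s := v / n.+1%:R.
have s_itv : 0 <= s <= 2 * pi.
  rewrite divr_ge0//= ler_pdivrMr// -ler_pdivrMl// mulrC.
  have : v / (2 * pi) < n%:R by rewrite archi_boundP// divr_ge0// ltW.
  by move=> /ltW /le_trans; apply; rewrite ler_nat.
have Ik k : I (u + s *+ k) = I u.
  by elim: k => [|k IH]; rewrite ?addr0// mulrSr addrA integral_period_step.
by rewrite -(Ik n.+1) -mulr_natr divfK.
Qed.

End periodic.

Lemma ge0_integral_circle (f : circle R -> \bar R) :
  measurable_fun setT f -> (forall z, (0 <= f z)%E) ->
  (\int[@circle_measure R]_z f z =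
   ((2 * pi)^-1)%:E * \int[mu]_(x in `]0%R, (2 * pi)%R]) f (expi x))%E.
Proof.
move=> mf f0.
have mfe : measurable_fun [set: R] (f \o @expi R).
  by apply: measurableT_comp => //; exact: measurable_expi.
rewrite ge0_integral_pushforward//; last exact: measurable_expi.
rewrite preimage_setT (integral_uniform (two_pi_gt0 R) mfe); last by move=> x; exact: f0.
rewrite subr0; congr (_ * _)%E.
by rewrite -integral_itv_obnd_cbnd//; exact: measurable_funS mfe.
Qed.

(** In the angle, a rotation is a translation, and the integral of a periodic function over a period
    does not depend on where the period starts. *)
Lemma ge0_integral_circle_mul (y : R) (f : circle R -> \bar R) :
  measurable_fun setT f -> (forall z, (0 <= f z)%E) ->
  (\int[@circle_measure R]_z f (circle_mul z (expi y)) =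
   \int[@circle_measure R]_z f z)%E.
Proof.
move=> mf f0.
have mfe : measurable_fun [set: R] (f \o @expi R).
  by apply: measurableT_comp => //; exact: measurable_expi.
rewrite !ge0_integral_circle//; last first.
  by apply: measurableT_comp => //; exact: measurable_circle_mul.
congr (_ * _)%E.
under eq_integral do rewrite circle_mul_expi.
have := @integral_period (f \o @expi R) mfe (fun=> f0 _) _ y 0.
rewrite add0r => <- => [|x]; last by rewrite /= expiD2pi.
rewrite -(ge0_integral_translation y)//; last by move=> x; exact: f0.
congr (integral _ _ _); apply/seteqP; split => x /=; rewrite !in_itv/= => /andP[? ?];
  by apply/andP; split; lra.
Qed.

End circle_rotation.

(** * Fields of Hilbert-Schmidt operators *)

Section bounded_operators.
Context {R : realType}.

(** The constant [M] of [bounded_op] is complex. Since [M * |x|] dominates a norm, it is nonnegative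
    and equals its modulus, so [|M|] may replace [M]. *)
Lemma bounded_opP (H K : hilbertType R) (T : H -> K) : bounded_op T ->
  linear T /\ exists2 r : R, 0 <= r & forall x, rnorm (T x) <= r * rnorm x.
Proof.
move=> [lT [M TM]]; split=> //; exists (complex.Re `|M|).
  by rewrite -lec_rc -(normcplx_rc (normr_ge0 M)); exact: normr_ge0.
move=> x; rewrite -lec_rc rcM -(normcplx_rc (normr_ge0 M)) -!rnormE.
apply: (le_trans (TM x)).
have Mx0 : 0 <= M * `|x| by exact: le_trans (normr_ge0 _) (TM x).
by rewrite -[X in X <= _](ger0_norm Mx0) normrM normr_id.
Qed.

Lemma linear_le_cvg (V W : normedModType (cplx R)) (f : V -> W) (r : R)
    {I : Type} {F : set_system I} {FF : Filter F} (u : I -> V) x :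
  linear f -> (forall x, rnorm (f x) <= r * rnorm x) ->
  u @ F --> x -> f (u i) @[i --> F] --> f x.
Proof.
move=> lf fr ux; apply/subr_cvg0; apply: cvg_rnorm0.
have h1 : (fun=> 0 : R) @ F --> (0 : R) by exact: cvg_cst.
have h2 : r * rnorm (u i - x) @[i --> F] --> (0 : R).
  by rewrite -[X in _ --> X](mulr0 r); apply: cvgM; [exact: cvg_cst|exact: cvgr_rnorm].
apply: squeeze_cvgr h1 h2; near=> i.
by rewrite rnorm_ge0/= -linear_funB.
Unshelve. all: by end_near. Qed.

End bounded_operators.

(** * Expansions in an orthonormal basis *)

Section orthonormal_bases.
Context {R : realType} {H : hilbertType R}.
Variable phi : nat -> H.
Hypothesis hphi : orthonormal_basis phi.

Definition sqr_abs (z : cplx R) : R := complex.Re z ^+ 2 + complex.Im z ^+ 2.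

Lemma sqr_abs_ge0 z : 0 <= sqr_abs z.
Proof. by rewrite addr_ge0// sqr_ge0. Qed.

Let P (x : H) n := series (fun k => inner x (phi k) *: phi k) n.

Lemma fourier_sum_orth x n m : (n <= m)%N -> inner (P x n) (phi m) = 0.
Proof.
elim: n => [|n IH] nm; first by rewrite /P /series/= big_nil inner0l.
rewrite /P seriesSr innerDl IH; last exact: ltnW.
by rewrite innerZl (proj1 hphi) ltn_eqF// mulr0 addr0.
Qed.

Lemma fourier_sum_norm x n :
  rnorm (P x n) ^+ 2 = \sum_(0 <= k < n) sqr_abs (inner x (phi k)).
Proof.
elim: n => [|n IH]; first by rewrite /P /series/= !big_nil rnorm0 expr0n.
rewrite big_nat_recr//= -IH -!inrxx /P seriesSr -/(P x n).
set c := inner x (phi n).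
have Pn : inner (P x n) (c *: phi n) = 0 by rewrite innerZr fourier_sum_orth// mulr0.
rewrite !inrE (inrC (c *: phi n) (P x n)) {2 3}/inr Pn addr0 add0r; congr (_ + _).
rewrite /inr innerZl innerZr (proj1 hphi) eqxx mulr1 conjcplxE ReM /=.
by rewrite /sqr_abs; ring.
Qed.

(** The norms of the partial Fourier sums converge to that of [x]. This expresses norms through
    matrix coefficients, the quantities whose measurability is part of [square_integrable_field]. *)
Lemma parseval x :
  (rnorm x ^+ 2)%:E = (\sum_(0 <= k <oo) (sqr_abs (inner x (phi k)))%:E)%E.
Proof.
apply/esym/cvg_lim => //.
rewrite (_ : (fun n => _) = EFin \o (fun n => rnorm (P x n) ^+ 2)); last first.
  by apply/funext => n /=; rewrite sumEFin fourier_sum_norm.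
apply: cvg_EFin; first by near=> n.
apply: cvgM; exact: cvg_rnorm (proj2 hphi x).
Unshelve. all: by end_near. Qed.

Lemma bounded_op_basis_ext (K : hilbertType R) (S T : H -> K) :
  bounded_op S -> bounded_op T -> (forall k, S (phi k) = T (phi k)) ->
  forall x, S x = T x.
Proof.
move=> /bounded_opP[lS [s _ Ss]] /bounded_opP[lT [r _ Tr]] ST x.
have SP : S (P x n) @[n --> \oo] --> S x by exact: linear_le_cvg lS Ss (proj2 hphi x).
have TP : T (P x n) @[n --> \oo] --> T x by exact: linear_le_cvg lT Tr (proj2 hphi x).
have PST n : S (P x n) = T (P x n).
  elim: n => [|n IH]; first by rewrite /P /series/= big_nil !linear_fun0.
  rewrite /P seriesSr (linear_funD _ _ lS) (linear_funD _ _ lT) -/(P x n) IH.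
  by rewrite (linear_funZ _ _ lS) (linear_funZ _ _ lT) ST.
have TS : S (P x n) @[n --> \oo] --> T x by under eq_cvg do rewrite PST.
by apply: (cvg_unique _ SP TS); exact: norm_hausdorff.
Qed.

End orthonormal_bases.

(** * Square-integrable fields modulo null sets *)

Section hs_fields.
Context {d : measure_display} {X : measurableType d} {R : realType}.
Variables (mu : {measure set X -> \bar R}) (H : hilbertType R) (phi : nat -> H).
Hypothesis hphi : orthonormal_basis phi.
Local Notation sqint := (square_integrable_field mu phi).
Implicit Types (S T : X -> H -> H).

Lemma hs_norm2_ge0 (T : H -> H) : (0 <= hs_norm2 phi T)%E.
Proof. by apply: nneseries_ge0 => k _ _; rewrite lee_fin sqr_ge0. Qed.

Lemma hs_norm2_eq0 (T : H -> H) : hs_norm2 phi T = 0%E <-> forall k, T (phi k) = 0.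
Proof.
split=> [T0 k|T0]; last first.
  by apply: eseries0 => k _ _; rewrite T0 rnorm0 expr0n.
have : ((rnorm (T (phi k)) ^+ 2)%:E <= hs_norm2 phi T)%E.
  rewrite /hs_norm2 (nneseriesD1 (n := k))//=; last first.
    by move=> j _; rewrite lee_fin sqr_ge0.
  by rewrite leeDl// nneseries_ge0// => j _ _; rewrite lee_fin sqr_ge0.
rewrite T0 lee_fin => Tk; apply/eqP; rewrite -rnorm_eq0 -sqrf_eq0.
by rewrite eq_le Tk sqr_ge0.
Qed.

(** Termwise [(u * s + t) ^ 2 <= 2 * u ^ 2 * s ^ 2 + 2 * t ^ 2]. The crude constants suffice, since
    only finiteness is drawn from the bound. *)
Lemma hs_norm2_lincomb (a : cplx R) (S T : H -> H) :
  (hs_norm2 phi (fun v => (a *: S v + T v)%R) <=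
   (2 * complex.Re `|a| ^+ 2)%:E * hs_norm2 phi S + 2%:E * hs_norm2 phi T)%E.
Proof.
have ge0 (c : R) (U : H -> H) k : 0 <= c -> (0 <= c%:E * (rnorm (U (phi k)) ^+ 2)%:E)%E.
  by move=> c0; rewrite -EFinM lee_fin mulr_ge0// sqr_ge0.
have a0 : 0 <= 2 * complex.Re `|a| ^+ 2 by rewrite mulr_ge0// sqr_ge0.
rewrite /hs_norm2 -!nneseriesZl; do ?by move=> k _; rewrite lee_fin sqr_ge0.
rewrite -nneseriesD; do ?by move=> k _ _; exact: ge0.
apply: lee_nneseries => [k _ _|k _]; first by rewrite lee_fin sqr_ge0.
rewrite -!EFinM -EFinD lee_fin.
have := rnormD (a *: S (phi k)) (T (phi k)); rewrite rnormZ.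
set u := complex.Re `|a|; set s := rnorm (S _); set t := rnorm (T _) => le.
apply: (@le_trans _ _ ((u * s + t) ^+ 2)).
  by rewrite lerXn2r ?nnegrE ?rnorm_ge0// (le_trans (rnorm_ge0 _) le).
have := sqr_ge0 (u * s - t); nra.
Qed.

Lemma bounded_op_lincomb (K L : hilbertType R) (a : cplx R) (S T : K -> L) :
  bounded_op S -> bounded_op T -> bounded_op (fun v => a *: S v + T v).
Proof.
move=> [lS [s Ss]] [lT [t Tt]]; split.
  move=> c x y; rewrite lS lT !scalerDr !scalerA (mulrC a c) -!addrA; congr (_ + _).
  by rewrite addrCA.
exists (`|a| * s + t) => x; rewrite mulrDl (le_trans (ler_normD _ _))// lerD//.
by rewrite normrZ -mulrA ler_wpM2l.
Qed.

Lemma hilbert_schmidt_lincomb (a : cplx R) (S T : H -> H) :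
  hilbert_schmidt phi S -> hilbert_schmidt phi T ->
  hilbert_schmidt phi (fun v => a *: S v + T v).
Proof.
move=> [bS hS] [bT hT]; split; first exact: bounded_op_lincomb.
apply: le_lt_trans (hs_norm2_lincomb _ _ _) _.
by apply: lte_add_pinfty; apply: lte_mul_pinfty => //; rewrite lee_fin// mulr_ge0// sqr_ge0.
Qed.

Lemma measurable_hs_norm2 T :
  (forall j k,
    measurable_fun setT (fun x => complex.Re (inner (T x (phi j)) (phi k))) /\
    measurable_fun setT (fun x => complex.Im (inner (T x (phi j)) (phi k)))) ->
  measurable_fun setT (fun x => hs_norm2 phi (T x)).
Proof.
move=> mT; apply: ge0_emeasurable_sum => [k x _ _|k _]; first by rewrite lee_fin sqr_ge0.
under eq_fun do rewrite (parseval hphi).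
apply: ge0_emeasurable_sum => [j x _ _|j _]; first by rewrite lee_fin sqr_abs_ge0.
by apply/measurable_EFinP; apply: measurable_funD; apply: measurable_funX;
  have [] := mT k j.
Qed.

Lemma sqint_measurable T : sqint T -> measurable_fun setT (fun x => hs_norm2 phi (T x)).
Proof. by move=> [_ mT _]; exact: measurable_hs_norm2. Qed.

Lemma sqint_lincomb (a : cplx R) S T : sqint S -> sqint T ->
  sqint (fun x v => a *: S x v + T x v).
Proof.
move=> sS sT; have mhS := sqint_measurable sS; have mhT := sqint_measurable sT.
move: sS sT => [hS mS iS] [hT mT iT].
have mL j k :
    measurable_fun setT (fun x => complex.Re (inner (a *: S x (phi j) + T x (phi j)) (phi k))) /\
    measurable_fun setT (fun x => complex.Im (inner (a *: S x (phi j) + T x (phi j)) (phi k))).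
  have [mS1 mS2] := mS j k; have [mT1 mT2] := mT j k.
  under eq_fun do rewrite innerPl ReD ReM.
  under [X in _ /\ measurable_fun _ X]eq_fun do rewrite innerPl ImD ImM.
  split; apply: measurable_funD => //.
    by apply: measurable_funB; apply: measurable_funM.
  by apply: measurable_funD; apply: measurable_funM.
split=> [x||].
- exact: hilbert_schmidt_lincomb.
- exact: mL.
have a0 : 0 <= 2 * complex.Re `|a| ^+ 2 by rewrite mulr_ge0// sqr_ge0.
apply: (@le_lt_trans _ _ (\int[mu]_x
  ((2 * complex.Re `|a| ^+ 2)%:E * hs_norm2 phi (S x) + 2%:E * hs_norm2 phi (T x)))%E).
  apply: ge0_le_integral => //.
  - by move=> x _; exact: hs_norm2_ge0.
  - exact: measurable_hs_norm2 mL.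
  - by apply: emeasurable_funD; apply: measurable_funeM.
  - by move=> x _; exact: hs_norm2_lincomb.
rewrite ge0_integralD//; do ?[by apply: measurable_funeM|
  by move=> x _; rewrite mule_ge0 ?hs_norm2_ge0 ?lee_fin].
rewrite !ge0_integralZl_EFin//; do ?by move=> x _; exact: hs_norm2_ge0.
by apply: lte_add_pinfty; apply: lte_mul_pinfty => //; rewrite lee_fin.
Qed.

Variables (K : hilbertType R) (cls : (X -> H -> H) -> K).
Hypothesis hK : direct_integral_HS mu phi cls.

Lemma direct_integral_dist S T : sqint S -> sqint T ->
  (rnorm (cls T - cls S) ^+ 2)%:E =
  (\int[mu]_x hs_norm2 phi (fun v => ((- 1) *: S x v + T x v)%R))%E.
Proof.
move=> sS sT; have [clsP clsN _] := hK.
by rewrite -clsN; [rewrite clsP// scaleN1r addrC|exact: sqint_lincomb].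
Qed.

(** The squared distance is the integral of a nonnegative function, which vanishes exactly when the
    function does almost everywhere. Equality is tested on basis vectors because [hs_norm2] sees
    only these. *)
Lemma direct_integral_eqP S T : sqint S -> sqint T ->
  cls S = cls T <-> {ae mu, forall x, forall k, S x (phi k) = T x (phi k)}.
Proof.
move=> sS sT; have sD := sqint_lincomb (- 1) sS sT; have mD := sqint_measurable sD.
have ST x k : (- 1) *: S x (phi k) + T x (phi k) = 0 <-> S x (phi k) = T x (phi k).
  rewrite scaleN1r addrC; split=> [/eqP|->]; last by rewrite subrr.
  by rewrite subr_eq0 => /eqP.
have dE := direct_integral_dist sS sT.
split=> [clsST|aeST].
  have i0 : (\int[mu]_x `|hs_norm2 phi (fun v => ((- 1) *: S x v + T x v)%R)| = 0)%E.
    under eq_integral do rewrite gee0_abs ?hs_norm2_ge0//.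
    by rewrite -dE clsST subrr rnorm0 expr0n.
  have /ae_eq_integral_abs := i0; move=> /(_ measurableT mD).
  by apply: filterS => x /(_ Logic.I) /hs_norm2_eq0 h k; apply/ST; exact: h.
apply/eqP; rewrite eq_sym -subr_eq0 -rnorm_eq0 -sqrf_eq0 -eqe dE.
rewrite (ae_eq_integral (cst 0%E))//; first by rewrite integral0.
by apply: filterS aeST => x h _; apply/hs_norm2_eq0 => k; apply/ST.
Qed.

End hs_fields.

(** * The antipode and the scaling group *)

Section cstar_algebra.
Context {R : realType} {A : cstarType R}.
Implicit Types (x y z : A) (c : cplx R).

Lemma cmulDl x y z : (x + y) ** z = x ** z + y ** z.
Proof. by have := cmulPl 1 x y z; rewrite !scale1r. Qed.

Lemma cmulDr x y z : x ** (y + z) = x ** y + x ** z.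
Proof. by have := cmulPr 1 x y z; rewrite !scale1r. Qed.

Lemma cmul0l z : 0 ** z = 0 :> A.
Proof. by apply: (addrI (0 ** z)); rewrite -cmulDl !addr0. Qed.

Lemma cmul0r z : z ** 0 = 0 :> A.
Proof. by apply: (addrI (z ** 0)); rewrite -cmulDr !addr0. Qed.

Lemma cmulZl c x z : (c *: x) ** z = c *: (x ** z).
Proof. by have := cmulPl c x 0 z; rewrite cmul0l !addr0. Qed.

Lemma cmulZr c x z : x ** (c *: z) = c *: (x ** z).
Proof. by have := cmulPr c x z 0; rewrite cmul0r !addr0. Qed.

Lemma cmulNl x z : (- x) ** z = - (x ** z).
Proof. by rewrite -scaleN1r cmulZl scaleN1r. Qed.

Lemma star0 : star 0 = 0 :> A.
Proof.
have := starP 1 0 (0 : A); rewrite conjC1 !scale1r addr0 => s0.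
by apply: (addrI (star 0)); rewrite addr0 -s0.
Qed.

Lemma starZ c x : star (c *: x) = Num.conj c *: star x.
Proof. by have := starP c x 0; rewrite star0 !addr0. Qed.

End cstar_algebra.

(** * Counit, antipode and squared antipode on the generators *)

Section antipode_of_generators.
Context {R : realType}.
Variables (q : R) (A : cstarType R) (alpha gamma : A).
Hypothesis rel : SUq2_relations q alpha gamma.
Local Notation Pol := (PolSUq2 alpha gamma).

Lemma Pol0 : Pol 0.
Proof.
by have := PolP (-1) (Pol1 alpha gamma) (Pol1 alpha gamma); rewrite scaleN1r addNr.
Qed.

Section linear_on_Pol.
Context {V : lmodType (cplx R)} {f : A -> V}.
Hypothesis lf : linear_on_Pol alpha gamma f.

Lemma linear_on_Pol0 : f 0 = 0.
Proof.
have := lf 1 Pol0 Pol0; rewrite !scale1r addr0 => f00.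
by apply: (addrI (f 0)); rewrite addr0 -f00.
Qed.

Lemma linear_on_PolZ c x : Pol x -> f (c *: x) = c *: f x.
Proof. by move=> Px; have := lf c Px Pol0; rewrite !addr0 linear_on_Pol0 addr0. Qed.

End linear_on_Pol.

Lemma gamma_star_alpha : gamma ** star alpha = rc q *: (star alpha ** gamma).
Proof.
have [_ _ _ _ rel5] := rel.
by have := congr1 star rel5; rewrite starM starZ starM starK conj_rc.
Qed.

Hypothesis free : forall a b : cplx R, a *: alpha + b *: gamma = 0 -> a = 0 /\ b = 0.
Hypothesis q_neq0 : q != 0.

Let Pa : Pol alpha := Pol_alpha alpha gamma.
Let Pg : Pol gamma := Pol_gamma alpha gamma.

(** Coefficients of [alpha] and [gamma] are compared in the counit identity at the two generators;
    [free] makes this legitimate. *)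
Lemma counit_of_generators (eps : A -> (cplx R)^o) :
  linear_on_Pol alpha gamma eps ->
  (forall x s, comul q alpha gamma x s -> \sum_(p <- s) eps p.1 *: p.2 = x) ->
  [/\ eps alpha = 1, eps gamma = 0, eps (star alpha) = 1 & eps (star gamma) = 0].
Proof.
move=> leps epsP.
have := epsP _ _ (comul_alpha q alpha gamma).
rewrite !big_cons big_nil addr0 /= (linear_on_PolZ leps); last exact: Pol_star.
move=> /eqP; rewrite -subr_eq0 addrAC -[X in _ - X]scale1r -scalerBl => /eqP.
move=> /free[/eqP ea /eqP eg'].
have := epsP _ _ (comul_gamma q alpha gamma).
rewrite !big_cons big_nil addr0 /=.
move=> /eqP; rewrite -subr_eq0 -addrA -[X in _ - X]scale1r -scalerBl => /eqP.
move=> /free[eg /eqP ea'].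
split=> //; apply/eqP; first by rewrite -subr_eq0.
  by rewrite -subr_eq0.
by move: eg'; rewrite mulf_eq0 oppr_eq0 rc_eq0 (negbTE q_neq0).
Qed.

Lemma antipode_of_generators (S : A -> A) : antipode q alpha gamma S ->
  [/\ linear_on_Pol alpha gamma S, S alpha = star alpha, S (star alpha) = alpha
    & S gamma = - rc q *: gamma].
Proof.
move=> [eps [lS leps epsP SP]].
have [ea eg ea' eg'] := counit_of_generators leps (fun x s h => proj1 (epsP x s h)).
have [rel1 rel2 rel3 rel4 rel5] := rel; have rel6 := gamma_star_alpha.
(* [E1] to [E4] are the left antipode identity at [alpha], [star gamma], [gamma] and [star alpha].
   Each value of [S] is then found by multiplying with a unit expanded by [rel1] or [rel2]. *)
have [] := SP _ _ (comul_alpha q alpha gamma).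
rewrite !big_cons !big_nil !addr0 /= ea scale1r.
rewrite (linear_on_PolZ lS); last exact: Pol_star.
rewrite cmulZl => E1 _.
have [] := SP _ _ (comul_star (comul_gamma q alpha gamma)).
rewrite !big_cons !big_nil !addr0 /= eg' scale0r starK => E2 _.
have [] := SP _ _ (comul_gamma q alpha gamma).
rewrite !big_cons !big_nil !addr0 /= eg scale0r => E3 _.
have [] := SP _ _ (comul_star (comul_alpha q alpha gamma)).
rewrite !big_cons !big_nil !addr0 /= ea' scale1r starZ starK rmorphN /= conj_rc.
rewrite (linear_on_PolZ lS)// cmulZl => E4 _.
have {}E1 : S alpha ** alpha = cstar1 + rc q *: (S (star gamma) ** gamma).
  by rewrite -E1 scaleNr subrK.
have {}E2 : S alpha ** star gamma = - (S (star gamma) ** star alpha).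
  by apply/eqP; rewrite -addr_eq0 addrC E2.
have E3' : S (star alpha) ** gamma = - (S gamma ** alpha).
  by apply/eqP; rewrite -addr_eq0 addrC E3.
have {}E3 : S gamma ** alpha = - (S (star alpha) ** gamma).
  by apply/eqP; rewrite -addr_eq0 E3.
have {}E4 : rc q *: (S gamma ** star gamma) = S (star alpha) ** star alpha - cstar1.
  by rewrite -E4 [in RHS]scaleNr cmulNl cmulZl opprB addrC subrK.
split=> //.
(* Both summands produce a multiple of [S (star gamma) ** star alpha ** gamma]; by [rel6] these
   cancel and [star alpha] remains. *)
- rewrite -[LHS]cmul1r -rel2 cmulDr cmulA E1 cmulZr rel3 cmulA E2.
  rewrite cmulDl cmul1l cmulZl -cmulA rel6 cmulZr scalerA -expr2 -rcX.
  by rewrite cmulNl scalerN -cmulA addrK.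
(* The terms in [S gamma] cancel by [rel5], which leaves [alpha]. *)
- rewrite -[LHS]cmul1r -rel1 cmulDr !cmulA.
  have -> : S (star alpha) ** star alpha = cstar1 + rc q *: (S gamma ** star gamma).
    by rewrite E4 addrC subrK.
  rewrite -(cmulA _ (star gamma)) -rel3 cmulA E3'.
  by rewrite cmulNl -[S gamma ** alpha ** _]cmulA rel5 cmulDl cmul1l cmulZl cmulZr -cmulA addrK.
(* The terms in [S (star alpha) ** star alpha ** gamma] cancel by [rel6]; the unit in [E4]
   contributes [- rc q *: gamma]. *)
- rewrite -[LHS]cmul1r -rel2 cmulDr !cmulA E3 cmulZr rel3.
  rewrite (cmulA (S gamma)) rcX expr2 -scalerA -cmulZl E4 cmulDl !cmulNl cmul1l.
  rewrite scalerBr -!cmulA rel6 cmulZr addrA.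
  by rewrite addNr add0r scaleNr.
Qed.

(** [Ru] is an involution commuting with [tauz], so two factors [tauz (- i / 2)] combine and the
    square of the antipode is [tauz (- ic)]. The factor [rc 1] gives both generators the same
    eigenvector form. *)
Lemma scaling_group_generators (tau : R -> A -> A) :
  scaling_group q alpha gamma tau ->
  exists tauz : cplx R -> A -> A,
    [/\ [/\ forall z x, Pol x -> Pol (tauz z x),
            forall t x, Pol x -> tauz (rc t) x = tau t x,
            forall z w x, Pol x -> tauz (z + w) x = tauz z (tauz w x)
          & forall x, Pol x -> entire (fun z => tauz z x)],
        tauz (- ic) alpha = rc 1 *: alpha
      & tauz (- ic) gamma = rc (q ^+ 2) *: gamma].
Proof.
move=> [_ [Ru [tauz [[_ _ _ RuK _] RuPol tauzP Rutauz anti]]]].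
exists tauz; have [lS Sa Sa' Sg] := antipode_of_generators anti.
have [tPol _ tD _] := tauzP.
have SS x : Pol x -> Ru (tauz (0 -i* 2^-1)%C (Ru (tauz (0 -i* 2^-1)%C x))) = tauz (- ic) x.
  move=> Px; rewrite -Rutauz; last exact: tPol.
  rewrite RuK -tD//; congr (tauz _ x).
  apply/eqP; rewrite eq_complex /= addr0 oppr0 eqxx /= -opprD -[X in _ == - X]mul1r.
  by rewrite [X in _ == - (X * 1)](splitr 1) !div1r mulr1.
split=> //.
  by rewrite -SS// Sa Sa' scale1r.
rewrite -SS// Sg -rcN.
have := linear_on_PolZ lS (rc (- q)) Pg; rewrite /= => ->.
by rewrite Sg -rcN scalerA -rcM mulrNN expr2.
Qed.

End antipode_of_generators.

(** * Representations and the direct integral *)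

Section bounded_linear_maps.
Context {R : realType}.

Lemma linear_le_dense_ext (V W : normedModType (cplx R)) (f g : V -> W) (r s : R)
    (D : set V) :
  linear f -> (forall x, rnorm (f x) <= r * rnorm x) ->
  linear g -> (forall x, rnorm (g x) <= s * rnorm x) ->
  closure D = setT -> (forall x, D x -> f x = g x) -> forall x, f x = g x.
Proof.
move=> lf fr lg gs Dd fg x; apply/eqP; rewrite -subr_eq0 -rnorm_eq0.
rewrite eq_le rnorm_ge0 andbT; apply/ler_addgt0Pl => e e0; rewrite addr0.
(* The constants [r] and [s] may be negative, hence the absolute values; the added 1 keeps the
   denominator positive. *)
have d0 : 0 < e / (`|r| + `|s| + 1) by rewrite divr_gt0// ltr_wpDl// addr_ge0.
have [y Dy yx] := closureT_approx x Dd d0.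
have -> : f x - g x = f (x - y) + g (y - x).
  by rewrite (linear_funB _ _ lf) (linear_funB _ _ lg) (fg y Dy) addrA subrK.
apply: (le_trans (rnormD _ _)); have fe := fr (x - y); have ge := gs (y - x).
rewrite -(rnormN (x - y)) opprB in fe; move: fe ge.
set u := rnorm (y - x) in yx *; have u0 : 0 <= u := rnorm_ge0 _.
rewrite ltr_pdivlMr in yx; last by rewrite ltr_wpDl// addr_ge0.
have ru := ler_wpM2r u0 (ler_norm r); have su := ler_wpM2r u0 (ler_norm s).
by nra.
Qed.

Lemma is_derive_linear_le (V W : normedModType (cplx R)) (f : V -> W) (r : R)
    (G : (cplx R)^o -> V) (z : (cplx R)^o) (D : V) :
  linear f -> (forall x, rnorm (f x) <= r * rnorm x) ->
  is_derive z (1 : (cplx R)^o) G D ->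
  is_derive z (1 : (cplx R)^o) (f \o G) (f D).
Proof.
move=> lf fr [dG GD].
have cv : h^-1 *: ((f \o G) (h *: (1 : (cplx R)^o) + z) - (f \o G) z)
    @[h --> (0 : (cplx R)^o)^'] --> f D.
  have := linear_le_cvg lf fr dG; rewrite -/(derive G _ _) GD.
  move=> lim; apply: (cvg_near_eq (lim _)); near=> h.
  by rewrite /= (linear_funZ _ _ lf) (linear_funB _ _ lf).
apply: DeriveDef; first exact: cvgP cv.
by apply: cvg_lim cv; exact: norm_hausdorff.
Unshelve. all: by end_near. Qed.

Lemma unitary_rnorm (H K : hilbertType R) (U : H -> K) x :
  unitary_op U -> rnorm (U x) = rnorm x.
Proof.
move=> [_ Ui _]; apply/eqP; rewrite -(eqrXn2 (ltn0Sn 1)) ?rnorm_ge0//.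
by rewrite -!inrxx /inr Ui.
Qed.

Lemma unitary_adjointK (H K : hilbertType R) (U : H -> K) (Us : K -> H) y :
  unitary_op U -> is_adjoint U Us -> U (Us y) = y.
Proof.
move=> [_ Ui Us_surj] adj; have [x <-] := Us_surj y; congr U.
by apply: inner_ext => z; rewrite innerC -adj Ui -innerC.
Qed.

End bounded_linear_maps.

Section imaginary_powers.
Context {R : realType} {H : hilbertType R}.

(** The left-hand side integrates a cosine against the spectral measure of [x], whose total mass is
    the squared norm of [x]. *)
Lemma imaginary_power_inr_le (P : unbounded_op H) (t : R) (U : H -> H) x :
  imaginary_power P t U -> inr (U x) x <= rnorm x ^+ 2.
Proof.
move=> [_ [E [m [[[_ _ _ ET mE] _ _ _] Ux]]]].
have mxT : m x setT = (rnorm x ^+ 2)%:E by rewrite mE// ET.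
have mD : measurable [set s : R | 0 < s].
  by rewrite -[X in measurable X]setTI; exact: measurable_fun_ltr.
have mxD : (m x [set s : R | (0 < s)%R] <= (rnorm x ^+ 2)%:E)%E.
  by rewrite -mxT le_measure ?inE.
have fin : (m x [set s : R | (0 < s)%R] < +oo)%E by apply: le_lt_trans mxD (ltry _).
rewrite /inr Ux /=.
apply: (@le_trans _ _ (\int[m x]_(s in [set s : R | 0 < s]) 1)).
  apply: le_Rintegral => //.
  - apply: measurable_bounded_integrable => //.
      apply: measurable_funTS; apply: measurableT_comp => //.
        by apply: continuous_measurable_fun; exact: continuous_cos.
      by apply: measurable_funM => //; exact: measurable_ln.
    exists 1; split=> // M M1 s _ /=; apply: le_trans (ltW M1).
    by rewrite ler_norml cos_geN1 cos_le1.
  - apply: measurable_bounded_integrable => //.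
    by exists 1; split=> // M M1 s _ /=; rewrite normr1 ltW.
rewrite (Rintegral_cst (m x) mD 1) mul1r -lee_fin fineK//.
by rewrite ge0_fin_numE.
Qed.

End imaginary_powers.

Section star_representations.
Context {R : realType} {A : cstarType R} {H : hilbertType R}.

Lemma star_rep_bounded_op (rho : A -> H -> H) a : star_rep rho -> bounded_op (rho a).
Proof. by move=> [l _ _ _ [_ le]]; split=> //; exists `|a| => x; exact: le. Qed.

Lemma star_rep_comp (B : cstarType R) (f : B -> A) (rho : A -> H -> H) :
  star_hom f -> star_rep rho -> star_rep (rho \o f).
Proof.
move=> [lf fM f1 fs fle] [l la lM l1 [ls lle]]; split=> //=.
- by move=> c a b x; rewrite lf la.
- by move=> a b x; rewrite fM lM.
- by move=> x; rewrite f1.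
- split=> [a x y|a x]; first by rewrite fs ls.
  by apply: le_trans (lle _ _) _; rewrite ler_wpM2r.
Qed.

(** The elements on which two representations agree form a closed unital *-subalgebra. Agreement of
    bounded operators need only be checked on the basis. *)
Lemma star_rep_SUq2_ext (alpha gamma : A) (phi : nat -> H) (rho sigma : A -> H -> H) :
  closure [set x | PolSUq2 alpha gamma x] = setT -> orthonormal_basis phi ->
  star_rep rho -> star_rep sigma ->
  (forall k, rho alpha (phi k) = sigma alpha (phi k)) ->
  (forall k, rho gamma (phi k) = sigma gamma (phi k)) ->
  forall a x, rho a x = sigma a x.
Proof.
move=> dense hphi rrho rsigma ea eg.
have extP a : (forall k, rho a (phi k) = sigma a (phi k)) -> forall x, rho a x = sigma a x.
  by move=> h; apply: (bounded_op_basis_ext hphi) => //; exact: star_rep_bounded_op.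
have pol a : PolSUq2 alpha gamma a -> forall x, rho a x = sigma a x.
  have [_ ra rM r1 [rs _]] := rrho; have [_ sa sM s1 [ss _]] := rsigma.
  elim=> [x|||b _ IH x|c b d _ IHb _ IHd x|b d _ IHb _ IHd x].
  - by rewrite r1 s1.
  - exact: extP.
  - exact: extP.
  - apply: inner_ext => y; rewrite innerC [RHS]innerC; congr Num.conj.
    by rewrite -rs -ss IH.
  - by rewrite ra sa IHb IHd.
  - by rewrite rM sM IHd IHb.
move=> a x.
have [lr ra _ _ [_ rle]] := rrho; have [ls sa _ _ [_ sle]] := rsigma.
have le (tau : A -> H -> H) : star_rep tau -> 
    forall b, rnorm (tau b x) <= rnorm x * rnorm b.
  move=> [_ _ _ _ [_ tle]] b; rewrite mulrC -lec_rc rcM -!rnormE; exact: tle.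
apply: (linear_le_dense_ext (f := rho^~ x) (g := sigma^~ x) (r := rnorm x)
  (s := rnorm x) _ _ _ _ dense) => //.
- by move=> c b d; rewrite ra.
- exact: le.
- by move=> c b d; rewrite sa.
- exact: le.
- by move=> b Pb; exact: pol.
Qed.

End star_representations.

(** * Rotation of fields over the circle *)

Section rotated_fields.
Context {R : realType} {H : hilbertType R}.
Variable phi : nat -> H.
Hypothesis hphi : orthonormal_basis phi.
Local Notation sqint := (square_integrable_field (@circle_measure R) phi).

Lemma sqint_rotate (y : R) T : sqint T -> sqint (fun z => T (circle_mul z (expi y))).
Proof.
move=> sT; have mhT := sqint_measurable hphi sT; move: sT => [hT mT iT]; split=> //.
  move=> j k; have [m1 m2] := mT j k.
  by split; [move: m1|move: m2] => m; apply: (measurableT_comp m);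
    exact: measurable_circle_mul.
rewrite (ge0_integral_circle_mul y (f := fun z => hs_norm2 phi (T z)))//.
by move=> z; exact: hs_norm2_ge0.
Qed.

Lemma direct_integral_rotate_dist (K : hilbertType R)
    (cls : (circle R -> H -> H) -> K) (y : R) S T :
  direct_integral_HS (@circle_measure R) phi cls -> sqint S -> sqint T ->
  rnorm (cls (fun z => T (circle_mul z (expi y))) -
         cls (fun z => S (circle_mul z (expi y)))) = rnorm (cls T - cls S).
Proof.
move=> hK sS sT; apply/eqP; rewrite -(eqrXn2 (ltn0Sn 1)) ?rnorm_ge0//; apply/eqP.
apply: EFin_inj; rewrite !(direct_integral_dist hphi hK)//; do ?exact: sqint_rotate.
apply: (ge0_integral_circle_mul y
  (f := fun z => hs_norm2 phi (fun v => ((- 1) *: S z v + T z v)%R))).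
  exact: (sqint_measurable hphi (sqint_lincomb hphi (- 1) sS sT)).
by move=> z; exact: hs_norm2_ge0.
Qed.

End rotated_fields.

Section scaling_group_eigenvectors.
Context {R : realType}.
Variables (q : R) (A : cstarType R) (alpha gamma : A).
Variables (H : hilbertType R) (Lambda : A -> H) (c : R).
Hypothesis Lambda_linear : linear Lambda.
Hypothesis Lambda_le : forall a, rnorm (Lambda a) <= c * rnorm a.
Variables (tau : R -> A -> A) (P : unbounded_op H) (Pit : R -> H -> H).
Hypothesis hPit : forall t, imaginary_power P t (Pit t).
Hypothesis hPtau : forall t a, Pit t (Lambda a) = Lambda (tau t a).
Hypothesis tau0 : forall x, tau 0 x = x.
Local Notation Pol := (PolSUq2 alpha gamma).

(** The orbit theorem for [F z = Lambda (tauz z x)]: boundedness of [Lambda] makes [F] entire, and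
    the group law with [hPtau] turns real translations into [Pit]. *)
Lemma scaling_group_eigen (tauz : cplx R -> A -> A) (x : A) (r : R) (t : R) :
  (forall z y, Pol y -> Pol (tauz z y)) ->
  (forall s y, Pol y -> tauz (rc s) y = tau s y) ->
  (forall z w y, Pol y -> tauz (z + w) y = tauz z (tauz w y)) ->
  Pol x -> entire (fun z => tauz z x) -> 0 < r -> tauz (- ic) x = rc r *: x ->
  Lambda (tau t x) = sval (expi (t * ln r)) *: Lambda x.
Proof.
move=> tPol tR tD Px [dF [_ FD]] r0 tx.
have t0 : tauz 0 x = x by rewrite -rc0 tR// tau0.
have Fd (z : (cplx R)^o) : is_derive z (1 : (cplx R)^o)
    (Lambda \o (fun z => tauz z x)) (Lambda (dF z)).
  exact: is_derive_linear_le Lambda_linear Lambda_le (FD z).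
have Ul s : linear (Pit s) by case: (hPit s) => -[].
have FU s (z : cplx R) : (Lambda \o (fun z => tauz z x)) (z + rc s) =
    Pit s ((Lambda \o (fun z => tauz z x)) z).
  by rewrite /= hPtau -tR; [rewrite -tD// addrC|exact: tPol].
have U_le s y : inr (Pit s y) y <= rnorm y ^+ 2 := imaginary_power_inr_le y (hPit s).
have F_eigen : (Lambda \o (fun z => tauz z x)) (- ic) =
    rc r *: (Lambda \o (fun z => tauz z x)) 0.
  by rewrite /= tx t0 linear_funZ.
have := entire_orbit_eigen Fd Ul FU U_le r0 F_eigen t.
by rewrite /= t0 tR.
Qed.

End scaling_group_eigenvectors.

(** * The scaling group seen through the representations *)

Section plancherel_representations.
Context {R : realType}.
Variables (q : R).
Hypotheses (q_itv : -1 < q < 1) (q_neq0 : q != 0).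
Variables (A : cstarType R) (alpha gamma : A).
Variables (H : hilbertType R) (phi : nat -> H).
Hypothesis hphi : orthonormal_basis phi.

Lemma sqr_lt1 : q ^+ 2 < 1.
Proof. by case/andP: q_itv => ? ?; nra. Qed.

Lemma D_eigenvalue_neq0 k : D_eigenvalue q k != 0.
Proof.
rewrite mulf_neq0// invr_neq0//; last by rewrite expf_neq0// normr_eq0.
by rewrite gt_eqF// sqrtr_gt0 subr_gt0 sqr_lt1.
Qed.

Lemma basis_neq0 k : phi k != 0.
Proof.
apply/eqP => phi0; have := proj1 hphi k k.
by rewrite phi0 inner0l eqxx => /esym/eqP; rewrite oner_eq0.
Qed.

(** [alpha] kills [phi 0] while [gamma] does not, so [b = 0]; then [phi 1], sent by [alpha] to a
    nonzero multiple of [phi 0], gives [a = 0]. *)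
Lemma psi2_free (lam : circle R) (rho : A -> H -> H) :
  psi2_rep q phi alpha gamma lam rho ->
  forall a b : cplx R, a *: alpha + b *: gamma = 0 -> a = 0 /\ b = 0.
Proof.
move=> [rrho rhoa rhog] a b ab0; have [_ rhoP _ _ _] := rrho.
have rho0 x : rho 0 x = 0.
  by have := rhoP (-1) 0 0 x; rewrite scaler0 addr0 scaleN1r addNr.
have abk k : a *: rho alpha (phi k) + b *: rho gamma (phi k) = 0.
  rewrite -[b *: rho gamma _]addr0 -(rho0 (phi k)) -!rhoP.
  by rewrite addr0 ab0 rho0.
have b0 : b = 0.
  have := abk 0; rewrite rhoa rhog scaler0 add0r scalerA.
  move=> /eqP; rewrite scaler_eq0 (negbTE (basis_neq0 0)) orbF expr0 mulr1.
  rewrite mulf_eq0 => /orP[/eqP//|/eqP lam0].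
  by have := svalP lam; rewrite lam0 normr0 eq_sym oner_eq0.
split=> //; have := abk 1; rewrite rhoa b0 scale0r addr0 scalerA.
move=> /eqP; rewrite scaler_eq0 (negbTE (basis_neq0 0)) orbF.
rewrite mulf_eq0 rc_eq0 => /orP[/eqP//|].
by rewrite muln1 gt_eqF// sqrtr_gt0 subr_gt0 sqr_lt1.
Qed.

Variables (psi : circle R -> A -> H -> H).
Hypothesis hpsi : forall lam, psi2_rep q phi alpha gamma lam (psi lam).
Variable (Dinv : H -> H).
Hypothesis hDinv : D_inverse q phi Dinv.
Variables (K : hilbertType R) (cls : (circle R -> H -> H) -> K).
Hypothesis hK : direct_integral_HS (@circle_measure R) phi cls.
Local Notation sqint := (square_integrable_field (@circle_measure R) phi).
Local Notation field a := (fun lam v => psi lam a (Dinv v)).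
Hypothesis field_sqint : forall a, sqint (field a).
Hypothesis dense : closure [set x | PolSUq2 alpha gamma x] = setT.

(** Fibrewise, [psi lam a] has norm at most that of [a], so the class of the field of the unit
    supplies the constant. Through the isometry of [QL] this will bound [Lambda]. *)
Lemma field_bounded : exists c : R, forall a, rnorm (cls (field a)) <= c * rnorm a.
Proof.
exists (rnorm (cls (field cstar1))) => a.
rewrite -ler_sqr ?nnegrE ?mulr_ge0 ?rnorm_ge0// exprMn mulrC -lee_fin.
have [_ clsN _] := hK; rewrite clsN// (EFinM (rnorm a ^+ 2)) clsN//.
rewrite -ge0_integralZl_EFin ?sqr_ge0//; last 2 first.
- by move=> lam _; exact: hs_norm2_ge0.
- exact: sqint_measurable (field_sqint cstar1).
apply: ge0_le_integral => //.
- by move=> lam _; exact: hs_norm2_ge0.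
- exact: sqint_measurable (field_sqint a).
- by apply: measurable_funeM; exact: sqint_measurable (field_sqint cstar1).
move=> lam _; rewrite -nneseriesZl; last by move=> k _; rewrite lee_fin sqr_ge0.
apply: lee_nneseries => [k _ _|k _]; first by rewrite lee_fin sqr_ge0.
have [[_ _ _ r1 [_ rle]] _ _] := hpsi lam.
rewrite r1 -EFinM lee_fin -exprMn lerXn2r ?nnegrE ?mulr_ge0 ?rnorm_ge0//.
by rewrite -lec_rc rcM -!rnormE; exact: rle.
Qed.

(** Rotating [lam] leaves [psi lam alpha] unchanged and multiplies [psi lam gamma] by the phase.
    Equal classes give equal operators almost everywhere, once the nonzero eigenvalues of [Dinv] are
    cancelled. *)
Lemma psi_rotate (y : R) (sigma : A -> A) : star_hom sigma ->
  cls (field (sigma alpha)) = cls (field alpha) ->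
  cls (field (sigma gamma)) = sval (expi y) *: cls (field gamma) ->
  forall a, cls (field (sigma a)) = cls (fun lam => field a (circle_mul lam (expi y))).
Proof.
move=> hsigma clsa clsg a.
have [clsP _ _] := hK.
have Dphi lam b k : psi lam b (Dinv (phi k)) =
    (rc (D_eigenvalue q k)^-1) *: psi lam b (phi k).
  have [[l _ _ _ _] _ _] := hpsi lam.
  by rewrite (proj2 hDinv) linear_funZ.
have Dinj k (u v : H) : rc (D_eigenvalue q k)^-1 *: u = rc (D_eigenvalue q k)^-1 *: v ->
    u = v.
  move=> /(congr1 (fun w => rc (D_eigenvalue q k) *: w)).
  by rewrite !scalerA -rcM divff ?D_eigenvalue_neq0// !scale1r.
have aea : {ae @circle_measure R, forall lam, forall k,
    psi lam (sigma alpha) (phi k) = psi lam alpha (phi k)}.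
  have /(direct_integral_eqP hphi hK (field_sqint _) (field_sqint _)) := clsa.
  by apply: filterS => lam h k; apply: (Dinj k); rewrite -!Dphi.
have aeg : {ae @circle_measure R, forall lam, forall k,
    psi lam (sigma gamma) (phi k) = sval (expi y) *: psi lam gamma (phi k)}.
  (* The multiple is written as a linear combination of the shape that [direct_integral_HS] provides
     for. *)
  have := clsg; have -> : sval (expi y) *: cls (field gamma) =
      cls (fun lam v => (sval (expi y) - 1) *: field gamma lam v + field gamma lam v).
    by rewrite clsP// scalerBl scale1r subrK.
  move=> /(direct_integral_eqP hphi hK (field_sqint _)
            (sqint_lincomb hphi _ (field_sqint _) (field_sqint _))).
  apply: filterS => lam h k; apply: (Dinj k); rewrite -Dphi h scalerBl scale1r subrK.
  by rewrite Dphi !scalerA mulrC.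
apply/(direct_integral_eqP hphi hK) => //.
  exact: sqint_rotate (field_sqint a).
(* The exceptional set comes from the two generators alone; outside it, the two representations
   agree on the whole algebra. *)
apply: filterS2 aea aeg => lam ha hg k.
have [rlam la lg] := hpsi lam; have [rlam' la' lg'] := hpsi (circle_mul lam (expi y)).
apply: (star_rep_SUq2_ext dense hphi (star_rep_comp hsigma rlam) rlam').
- by move=> j; rewrite /= ha la la'.
- by move=> j; rewrite /= hg lg lg' scalerA /= mulrCA mulrA.
Qed.

End plancherel_representations.

(** * The imaginary powers as rotations of the direct integral *)

Theorem proposition7p3 (R : realType) (q : R)
  (q_itv : -1 < q < 1) (q_neq0 : q != 0)
  (* C(SU_q(2)), its Haar state, GNS map and scaling group *)
  (A : cstarType R) (alpha gamma : A) (hA : universal_SUq2 q alpha gamma)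
  (h : A -> cplx R) (hh : haar_state q alpha gamma h)
  (L2G : hilbertType R) (Lambda : A -> L2G) (hLambda : gns_map h Lambda)
  (tau : R -> A -> A) (htau : scaling_group q alpha gamma tau)
  (* P and its imaginary powers *)
  (P : unbounded_op L2G) (hPsa : selfadjoint P) (hPpos : strictly_positive P)
  (Pit : R -> L2G -> L2G) (hPit : forall t, imaginary_power P t (Pit t))
  (hPtau : forall t a, Pit t (Lambda a) = Lambda (tau t a))
  (* l^2(Z_+), the representations psi^{2, lambda} and D^{-1} *)
  (l2 : hilbertType R) (phi : nat -> l2) (hphi : orthonormal_basis phi)
  (psi : circle R -> A -> l2 -> l2)
  (hpsi : forall lam, psi2_rep q phi alpha gamma lam (psi lam))
  (Dinv : l2 -> l2) (hDinv : D_inverse q phi Dinv)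
  (* the direct integral K of HS(l^2), and the unitary Q_L with adjoint QLs *)
  (K : hilbertType R) (cls : (circle R -> l2 -> l2) -> K)
  (hK : direct_integral_HS (@circle_measure R) phi cls)
  (QL : L2G -> K) (hQL : unitary_op QL)
  (hQLLambda : forall a,
     square_integrable_field (@circle_measure R) phi
       (fun lam v => psi lam a (Dinv v)) /\
     QL (Lambda a) = cls (fun lam v => psi lam a (Dinv v)))
  (QLs : K -> L2G) (hQLs : is_adjoint QL QLs)
  (t : R) (T : circle R -> l2 -> l2)
  (hT : square_integrable_field (@circle_measure R) phi T) :
  let T' := fun lam => T (circle_mul lam (expi_base `|q| (2 * t))) in
  square_integrable_field (@circle_measure R) phi T' /\
  QL (Pit t (QLs (cls T))) = cls T'.
Proof.
move=> T'.
have [rel dense _] := hA.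
have [Lambda_linear _ Lambda_dense] := hLambda.
have field_sqint a := proj1 (hQLLambda a).
have QLE a := proj2 (hQLLambda a).
have [QL_linear _ _] := hQL.
have sT' : square_integrable_field (@circle_measure R) phi T'.
  exact: sqint_rotate.
split=> //.
have [c Lambda_le] := field_bounded hphi hpsi hK field_sqint.
have {}Lambda_le a : rnorm (Lambda a) <= c * rnorm a.
  by rewrite -(unitary_rnorm _ hQL) QLE.
(* Any point of the circle would do; one representation already separates [alpha] and [gamma]. *)
have free := psi2_free q_itv hphi (hpsi (expi 0)).
have [[tau_hom tau0 _ _] _] := htau.
have [tauz [[tPol tR tD tE] tza tzg]] := scaling_group_generators rel free q_neq0 htau.
have q2_gt0 : 0 < q ^+ 2 by rewrite exprn_even_gt0.
have La : Lambda (tau t alpha) = Lambda alpha.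
  have := scaling_group_eigen Lambda_linear Lambda_le hPit hPtau tau0 t tPol tR tD
    (Pol_alpha _ _) (tE _ (Pol_alpha _ _)) ltr01 tza.
  rewrite ln1 mulr0 => ->.
  have -> : sval (expi 0) = 1 :> cplx R by rewrite /= cos0 sin0.
  by rewrite scale1r.
have Lg : Lambda (tau t gamma) = sval (expi (2 * t * ln `|q|)) *: Lambda gamma.
  (* The eigenvalue of [gamma] is [q ^+ 2]; the absolute value appears because [q] may be
     negative. *)
  have -> : 2 * t * ln `|q| = t * ln (q ^+ 2).
    by rewrite -real_normK ?num_real// lnXn ?normr_gt0//; ring.
  exact: (scaling_group_eigen Lambda_linear Lambda_le hPit hPtau tau0 t tPol tR tD
    (Pol_gamma _ _) (tE _ (Pol_gamma _ _)) q2_gt0 tzg).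
have rot := psi_rotate q_itv q_neq0 hphi hpsi hDinv hK field_sqint dense (tau_hom t).
have {}rot a : QL (Pit t (Lambda a)) = cls (fun lam v =>
    psi (circle_mul lam (expi_base `|q| (2 * t))) a (Dinv v)).
  rewrite hPtau QLE; apply: rot; rewrite -!QLE ?La// Lg.
  by rewrite linear_funZ.
set x := QLs (cls T); have QLx : QL x = cls T := (unitary_adjointK (cls T) hQL hQLs).
have [Pit_bounded _] := hPit t.
have [Pit_linear [r r0 Pit_le]] := bounded_opP Pit_bounded.
apply/eqP; rewrite -subr_eq0 -rnorm_eq0 eq_le rnorm_ge0 andbT.
apply/ler_addgt0Pl => e e0; rewrite addr0.
(* Both sides are continuous in the vector: [r] bounds [Pit t], and the 1 accounts for the rotation,
   an isometry. Hence an approximation of [x] by [Lambda a] suffices. *)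
have e0' : 0 < e / (r + 1) by rewrite divr_gt0// ltr_wpDl.
have [_ [a _ <-] ax] := closureT_approx x Lambda_dense e0'.
have -> : QL (Pit t x) - cls T' =
    QL (Pit t (x - Lambda a)) + (QL (Pit t (Lambda a)) - cls T').
  by rewrite (linear_funB _ _ Pit_linear) (linear_funB _ _ QL_linear) addrA subrK.
apply: le_trans (rnormD _ _) _.
rewrite (unitary_rnorm _ hQL) rot (direct_integral_rotate_dist hphi _ hK hT (field_sqint a)).
rewrite -QLE -QLx -(linear_funB _ _ QL_linear) (unitary_rnorm _ hQL).
have := Pit_le (x - Lambda a); rewrite -(rnormN (x - Lambda a)) opprB => Pa.
rewrite ltr_pdivlMr ?ltr_wpDl// in ax.
by apply: le_trans (lerD Pa (lexx _)) _; move: (ltW ax); set u := rnorm _; nra.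
Qed.
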